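(* Let $w\in S_n$. Then $${\overleftarrow{\mathfrak{G}}}_w(x;a)=(-1)^{\ell(w)}\sum_D(-1)^{|\lambda(D)|}\,\mathrm{wt}(D)\,G_{\lambda(D)}(x||a),$$ where the sum is over all $w$-rectangular $K$-bumpless pipedreams $D$.
   Context: $S_\mathbb{Z}$: permutations of $\mathbb{Z}$ fixing all but finitely many integers, generated by $s_i$ exchanging $i,i+1$; $\ell$ length; $S_n\subset S_+=\langle s_i:i>0\rangle$ the permutations of $\{1,\dots,n\}$; $\gamma(s_i)=s_{i+1}$. $a\ominus b=(a-b)/(1-b)$. $\tilde\pi_i f=\frac{(1-x_{i+1})f-(1-x_i)s_i(f)}{x_i-x_{i+1}}$. For $w\in S_n$: $\mathfrak{G}_{w_0}(x;a)=\prod_{i+j\le n}(x_i\ominus a_j)$, $\mathfrak{G}_w(x;a)=\tilde\pi_i\mathfrak{G}_{ws_i}(x;a)$ when $\ell(ws_i)>\ell(w)$. ${\overleftarrow{\mathfrak{G}}}_w(x;a)$ is the coefficientwise limit as $p\to-\infty$ of $\mathfrak{G}_{\gamma^{1-p}(w)}(x;a)$ with $x_i\mapsto x_{i+p-1}$, $a_i\mapsto a_{i+p-1}$. For a partition $\lambda$ put $s_{j-i}$ in box $(i,j)$; $w_\lambda$ is the product read from the last row to the first, each row right to left; $G_\lambda(x||a)={\overleftarrow{\mathfrak{G}}}_{w_\lambda}(x;a)$. Matrix coordinates: $(i,j)$ is row $i$, column $j$, rows increasing downward. Tiles: empty, NW elbow (pipe joining north and west edges), SE elbow (south and east), horizontal,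 vertical, crossing. A $w$-rectangular $K$-bumpless pipedream is a tiling, with matching pipe ends, of the $n\times 2n$ region $R_n=\{(i,j):i\in[1,n],\ j\in[1-n,n]\}$ in which pipes labelled $1-n,2-n,\dots,0,1,\dots,n$ enter the south boundary from left to right (one per column); the positively labelled pipes exit the east boundary and determine $w$ as follows: follow the pipe labelled $i$ until it exits east in row $j$, ignoring all crossings between pairs of pipes that have already crossed (reading pipes from southwest to northeast), and require $w(j)=i$; the nonpositively labelled pipes exit the north boundary and cross no other pipe. Its weight is $\mathrm{wt}(D)=\prod_{(i,j)\ \text{empty}}(-(x_i\ominus a_j))\prod_{(i,j)\ \text{NW elbow}}(1-(x_i\ominus a_j))$. The partition $\lambda(D)$ is obtained by reading the $2n$ north boundary edges from right to left and drawing the boundary of a partition inside an $n\times n$ box, where an edge with no pipe exiting gives a step to the left and an edge with a pipe exiting gives a downward step. *)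

(* Defs.v *)
From HB Require Import structures.
From mathcomp Require Import all_boot all_order all_algebra.
From mathcomp Require Import finmap multiset.
From mathcomp Require Import boolp classical_sets.

Set Implicit Arguments.
Unset Strict Implicit.
Unset Printing Implicit Defensive.

Import Order.TTheory GRing.Theory Num.Theory.
Local Open Scope ring_scope.

(* The ring Z[[x_i, a_i : i in Z]]: all functions from monomials to Z, where a
   monomial is a finite multiset of variables, inl i standing for x_i and
   inr i for a_i. *)

Definition var : choiceType := (int + int)%type.

Definition monom : choiceType := {mset var}%mset.

Section SubMonomials.
Local Open Scope mset_scope.
Implicit Types (m k l : {mset var}) (v : var).

Fixpoint subseqs (s : seq var) : seq (seq var) :=
  if s is v :: s' then subseqs s' ++ [seq v :: t | t <- subseqs s']
  else [:: [::]].

Definition submonoms (m : monom) : seq monom :=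
  undup [seq seq_mset t : monom | t <- subseqs (enum_mset m)].

Lemma submonoms_uniq m : uniq (submonoms m).
Proof. exact: undup_uniq. Qed.

Lemma mem_subseqs s k :
  (k \in [seq seq_mset t : {mset var} | t <- subseqs s]) = (k `<=` seq_mset s).
Proof.
elim: s k => [|v s IH] k /=.
  rewrite inE.
  have -> : seq_mset [::] = mset0 :> {mset var}.
    by apply/msetP => u; rewrite mset_seqE mset0E.
  by rewrite msubset0.
rewrite map_cat mem_cat IH mset_cons.
apply/orP/idP => [[/msubsetP h|]|h].
- by apply/msubsetP => u; rewrite mset1DE (leq_trans (h u)) ?leq_addl.
- rewrite -map_comp => /mapP[t ht ->] /=; rewrite mset_cons msetDS //.
  by rewrite -IH; apply: map_f.
case: (boolP (k `<=` seq_mset s)) => [|nk]; [by left|right].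
have vk : v \in k.
  apply: contraNT nk => /mset_eq0P vk; apply/msubsetP => u.
  move/msubsetP/(_ u): h; rewrite mset1DE.
  by case: (eqVneq u v) => [->|_]; rewrite ?vk.
have : k `\ v `<=` seq_mset s by rewrite subset_msetBLR.
rewrite -IH => /mapP[t ht e].
rewrite -map_comp; apply/mapP; exists t => //=.
by rewrite mset_cons -e msetB1K.
Qed.

Lemma mem_submonoms m k : (k \in submonoms m) = (k `<=` m).
Proof. by rewrite mem_undup mem_subseqs seq_mset_id. Qed.

Lemma submonoms_opp m :
  perm_eq [seq m `\` k : monom | k <- submonoms m] (submonoms m).
Proof.
apply: uniq_perm; rewrite ?submonoms_uniq //.
  rewrite map_inj_in_uniq ?submonoms_uniq // => k l.
  rewrite !mem_submonoms => hk hl e.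
  by rewrite -(msetBBK hk) e msetBBK.
move=> k; rewrite mem_submonoms; apply/mapP/idP => [[l _ ->]|h].
  exact: msubsetDl.
by exists (m `\` k); rewrite ?mem_submonoms ?msubsetDl ?msetBBK.
Qed.

Lemma submonoms_sub m k : k `<=` m ->
  perm_eq [seq k `+` l : monom | l <- submonoms (m `\` k)]
          [seq l <- submonoms m | k `<=` l].
Proof.
move=> km; apply: uniq_perm; rewrite ?filter_uniq ?submonoms_uniq //.
  by rewrite map_inj_uniq ?submonoms_uniq //; apply: can_inj (msetDKB k).
move=> l; rewrite mem_filter mem_submonoms; apply/mapP/idP => [[j]|/andP[kl lm]].
  rewrite mem_submonoms => jm ->; apply/andP; split.
    by apply/msubsetP => u; rewrite msetE2 leq_addr.
  by rewrite -[X in _ `<=` X](msetBDKC km) msetDS.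
by exists (l `\` k); rewrite ?msetBDKC // mem_submonoms msetSB.
Qed.

End SubMonomials.

Record series := Series { coef : monom -> int }.

Lemma seriesP (f g : series) : coef f =1 coef g -> f = g.
Proof. by case: f g => f [g] /= /funext ->. Qed.

HB.instance Definition _ := gen_eqMixin series.
HB.instance Definition _ := gen_choiceMixin series.

Definition szero := Series (fun=> 0).
Definition sopp f := Series (fun m => - coef f m).
Definition sadd f g := Series (fun m => coef f m + coef g m).

Lemma saddA : associative sadd.
Proof. by move=> f g h; apply: seriesP => m /=; rewrite addrA. Qed.
Lemma saddC : commutative sadd.
Proof. by move=> f g; apply: seriesP => m /=; rewrite addrC. Qed.
Lemma sadd0 : left_id szero sadd.
Proof. by move=> f; apply: seriesP => m /=; rewrite add0r. Qed.
Lemma saddN : left_inverse szero sopp sadd.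
Proof. by move=> f; apply: seriesP => m /=; rewrite addNr. Qed.

HB.instance Definition _ := GRing.isZmodule.Build series saddA saddC sadd0 saddN.

Definition sone := Series (fun m => (m == mset0)%:R).
Definition smul f g :=
  Series (fun m => \sum_(k <- submonoms m) coef f k * coef g (m `\` k)%mset).

Lemma smulC : commutative smul.
Proof.
move=> f g; apply: seriesP => m /=.
rewrite -(perm_big _ (submonoms_opp m)) /= big_map.
rewrite big_seq [RHS]big_seq; apply: eq_bigr => k.
by rewrite mem_submonoms => km; rewrite msetBBK // mulrC.
Qed.

Lemma smulA : associative smul.
Proof.
move=> f g h; apply: seriesP => m /=.
under [RHS]eq_bigr do rewrite mulr_suml.
transitivity (\sum_(k <- submonoms m) \sum_(l <- submonoms m | (l `<=` k)%mset)
   coef f l * coef g (k `\` l)%mset * coef h (m `\` k)%mset); last first.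
  rewrite big_seq [RHS]big_seq; apply: eq_bigr => k; rewrite mem_submonoms => km.
  rewrite -big_filter; apply: perm_big; apply: uniq_perm.
  - by rewrite filter_uniq ?submonoms_uniq.
  - exact: submonoms_uniq.
  move=> l; rewrite mem_filter !mem_submonoms andb_idr //.
  by move=> lk; apply: msubset_trans lk km.
rewrite (exchange_big_dep xpredT) //=.
rewrite big_seq [RHS]big_seq; apply: eq_bigr => k; rewrite mem_submonoms => km.
rewrite mulr_sumr -[RHS]big_filter -(perm_big _ (submonoms_sub km)) /= big_map.
by apply: eq_bigr => l _; rewrite msetDKB mulrA msetBDA.
Qed.

Lemma smul1 : left_id sone smul.
Proof.
move=> f; apply: seriesP => m /=.
rewrite (bigD1_seq (mset0 : monom)) ?submonoms_uniq ?mem_submonoms ?msub0set //=.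
rewrite eqxx mul1r msetB0 big1 ?addr0 // => k /negPf ->.
by rewrite mul0r.
Qed.

Lemma smulDl : left_distributive smul sadd.
Proof.
move=> f g h; apply: seriesP => m /=.
by rewrite -big_split; apply: eq_bigr => k _ /=; rewrite mulrDl.
Qed.

Lemma sone_neq0 : sone != 0.
Proof. by apply/eqP => -[/(congr1 (fun f => f mset0))]; rewrite eqxx. Qed.

HB.instance Definition _ := GRing.Zmodule_isComNzRing.Build series
  smulA smulC smul1 smulDl sone_neq0.

Definition svar (v : var) : series := Series (fun m => (m == [mset v]%mset)%:R).
Definition x_ (i : int) : series := svar (inl i).
Definition a_ (i : int) : series := svar (inr i).

(* Exact division: the ring is a domain, so the quotient is unique if it exists. *)
Definition sdiv (f g : series) : series := xget 0 (fun q => g * q = f).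

Definition ominus (a b : series) : series := sdiv (a - b) (1 - b).

(* For a bijection sigma of the variables with inverse tau, this substitutes
   sigma v for each variable v. *)
Definition rename (tau : var -> var) (f : series) : series :=
  Series (fun m => coef f (seq_mset [seq tau v | v <- enum_mset m])).

Lemma rename_svar (sigma tau : var -> var) (v : var) :
  cancel sigma tau -> cancel tau sigma -> rename tau (svar v) = svar (sigma v).
Proof.
move=> st ts; apply: seriesP => m /=; congr ((nat_of_bool _)%:R).
apply/eqP/eqP => [/msetP e|->].
  apply/msetP => u; have := e (tau u).
  rewrite mset_seqE count_map !msetnE (can2_eq ts st) => <-.
  by rewrite -count_mem_mset; apply: eq_count => z /=; rewrite (can_eq ts).
apply/msetP => u; rewrite enum_msetn mset_seqE /= st addn0 msetnE eq_sym.
by case: eqP.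
Qed.

Definition shift (d : int) : series -> series :=
  rename (fun v => match v with inl i => inl (i - d) | inr i => inr (i - d) end).

(* Elements of S_Z are represented by functions int -> int, and the product of
   permutations is composition of functions. *)

Definition s_ (i : int) : int -> int :=
  fun k => if k == i then i + 1 else if k == i + 1 then i else k.

Definition word_perm (u : seq int) : int -> int :=
  foldr (fun i w => s_ i \o w) id u.

Definition len (w : int -> int) : nat :=
  xget 0%N (fun k => (exists2 u, size u = k & word_perm u =1 w) /\
                     (forall u, word_perm u =1 w -> (k <= size u)%N)).

Definition in_S (n : nat) (w : int -> int) : Prop :=
  bijective w /\ forall i, ~~ (1 <= i <= n%:Z) -> w i = i.

Definition w0 (n : nat) : int -> int :=
  fun i => if 1 <= i <= n%:Z then n%:Z + 1 - i else i.

(* gamma d is the d-th power of the automorphism s_i |-> s_(i+1). *)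
Definition gamma (d : int) (w : int -> int) : int -> int :=
  fun i => w (i - d) + d.

Definition sx (i : int) : series -> series :=
  rename (fun v => if v is inl k then inl (s_ i k) else v).

Definition tpi (i : int) (f : series) : series :=
  sdiv ((1 - x_ (i + 1)) * f - (1 - x_ i) * sx i f) (x_ i - x_ (i + 1)).

Inductive is_groth (n : nat) : (int -> int) -> series -> Prop :=
| groth_w0 w : w =1 w0 n ->
    is_groth n w (\prod_(1 <= i < n) \prod_(1 <= j < n | (i + j <= n)%N)
                    ominus (x_ i%:Z) (a_ j%:Z))
| groth_tpi w (i : nat) g : (0 < i < n)%N -> (len w < len (w \o s_ i%:Z))%N ->
    is_groth n (w \o s_ i%:Z) g -> is_groth n w (tpi i%:Z g).

(* The series attached to w depends neither on the n with w in S_n nor on the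
   chosen chain of ascents. *)
Definition groth (w : int -> int) : series :=
  xget 0 (fun g => exists n, is_groth n w g).

Definition lim_minfty (u : int -> series) : series :=
  Series (fun m => xget 0 (fun c => exists p0 : int,
    forall p, p <= p0 -> coef (u p) m = c)).

Definition bs_groth (w : int -> int) : series :=
  lim_minfty (fun p => shift (p - 1) (groth (gamma (1 - p) w))).

(* Rows and columns of lam are counted from 0 here, which does not change the
   contents j - i. *)
Definition w_part (lam : seq nat) : int -> int :=
  word_perm (flatten (rev
    [seq [seq j%:Z - i%:Z | j <- rev (iota 0 (nth 0%N lam i))]
      | i <- iota 0 (size lam)])).

Definition G_part (lam : seq nat) : series := bs_groth (w_part lam).

Inductive tile := Empty | ElbowNW | ElbowSE | Horiz | Vert | Cross.

Definition tile_code (t : tile) : 'I_6 :=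
  match t with
  | Empty => inord 0 | ElbowNW => inord 1 | ElbowSE => inord 2
  | Horiz => inord 3 | Vert => inord 4 | Cross => inord 5
  end.
Definition tile_decode (k : 'I_6) : tile :=
  nth Empty [:: Empty; ElbowNW; ElbowSE; Horiz; Vert; Cross] k.
Lemma tile_codeK : cancel tile_code tile_decode.
Proof. by case; rewrite /tile_decode /= inordK. Qed.

HB.instance Definition _ := Countable.copy tile (can_type tile_codeK).
HB.instance Definition _ := Finite.copy tile (can_type tile_codeK).

(* The index (i, j) stands for the cell in row rowZ i and column colZ j of the
   region [1, n] x [1 - n, n]. *)
Definition tiling (n : nat) := {ffun 'I_n * 'I_(n.*2) -> tile}.

Section PipeDreams.
Variable n : nat.
Implicit Type D : tiling n.

Definition rowZ (i : 'I_n) : int := i.+1%:Z.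
Definition colZ (j : 'I_(n.*2)) : int := j%:Z + 1 - n%:Z.

(* A labelling of the edges by pipes (None = no pipe): west r c is the label of
   the west edge of the cell (r, c), hence of the east edge of (r, c - 1);
   south r c is the label of its south edge, hence of the north edge of
   (r + 1, c). *)
Definition labels := (int -> int -> option int)%type.

(* Pipes run from southwest to northeast. At a crossing between two pipes that
   have already crossed, the crossing is ignored, i.e. the pipes bounce off. *)
Definition tile_rule (t : tile) (crossed : Prop) (W S E N : option int) : Prop :=
  match t with
  | Empty => [/\ W = None, S = None, E = None & N = None]
  | ElbowNW => exists p, [/\ W = Some p, N = Some p, S = None & E = None]
  | ElbowSE => exists p, [/\ S = Some p, E = Some p, W = None & N = None]
  | Horiz => exists p, [/\ W = Some p, E = Some p, S = None & N = None]
  | Vert => exists p, [/\ S = Some p, N = Some p, W = None & E = None]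
  | Cross => exists p q, [/\ W = Some p, S = Some q,
                  crossed -> E = Some q /\ N = Some p &
                  ~ crossed -> E = Some p /\ N = Some q]
  end.

Definition already_crossed D (west south : labels) (c : 'I_n * 'I_(n.*2)) : Prop :=
  exists c' : 'I_n * 'I_(n.*2),
    [/\ c' != c, (c.1 <= c'.1)%N, (c'.2 <= c.2)%N, D c' = Cross &
     let e := (west (rowZ c.1) (colZ c.2), south (rowZ c.1) (colZ c.2)) in
     let e' := (west (rowZ c'.1) (colZ c'.2), south (rowZ c'.1) (colZ c'.2)) in
     e' = e \/ e' = (e.2, e.1)].

Definition rect_KBPD (w : int -> int) D : Prop :=
  exists west south : labels,
    (forall c, let r := rowZ c.1 in let k := colZ c.2 in
      tile_rule (D c) (already_crossed D west south c)
        (west r k) (south r k) (west r (k + 1)) (south (r - 1) k)) /\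
    [/\ forall j, south n%:Z (colZ j) = Some (colZ j),
        forall i, west (rowZ i) (1 - n%:Z) = None,
        forall i, west (rowZ i) (n%:Z + 1) = Some (w (rowZ i)),
        forall j p, south 0 (colZ j) = Some p -> p <= 0 &
        forall c p, D c = Cross ->
          west (rowZ c.1) (colZ c.2) = Some p \/
          south (rowZ c.1) (colZ c.2) = Some p -> 0 < p].

Definition wt D : series :=
  (\prod_(c | D c == Empty) - ominus (x_ (rowZ c.1)) (a_ (colZ c.2))) *
  (\prod_(c | D c == ElbowNW) (1 - ominus (x_ (rowZ c.1)) (a_ (colZ c.2)))).

Definition exits_north D (j : 'I_(n.*2)) : bool :=
  [exists i : 'I_n, (i == 0 :> nat) && (D (i, j) \in [:: ElbowNW; Vert; Cross])].

(* The lattice path starts at the northeast corner of the n x n box; c is the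
   current abscissa, so a downward step closes a row of length c. *)
Fixpoint path_part (c : nat) (steps : seq bool) : seq nat :=
  match steps with
  | [::] => [::]
  | true :: b => c :: path_part c b
  | false :: b => path_part c.-1 b
  end.

Definition lambda D : seq nat :=
  path_part n [seq exits_north D j | j <- rev (enum 'I_(n.*2))].

End PipeDreams.

(* Main.v *)
Require Import Defs.
From HB Require Import structures.
From mathcomp Require Import all_boot all_order all_algebra.
From mathcomp Require Import finmap multiset.
From mathcomp Require Import boolp classical_sets.
From mathcomp Require Import zify ring.
Import Order.TTheory GRing.Theory Num.Theory.
Local Open Scope ring_scope.

(** Follow the pipes from southwest to northeast: of two pipes meeting at a
crossing, the one with the smaller label leaves to the east, whether or not
they have crossed before. With this local rule, bumpless pipedreams form a
solvable lattice model, and the Yang-Baxter equation for two adjacent rows is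
the recursion of the operators [tpi]. Hence the Grothendieck series of [w] in
[S_n] is, up to sign, the partition function of the n x n square. The back
stable series is the limit of the partition functions of the squares
[p, n] x [p, n], since modulo x_{p-1} and a_{p-1} the first row and column of
the next larger square are forced. Cut such a square above row 1: the rows 1,
..., n give the rectangular pipedreams, and a nonpositive pipe which crosses
another pipe there cannot leave the square in the right row. The rows p, ..., 0
only see the relative order of the nonpositive pipes and the shape lambda of
their positions; for the Grassmannian permutation w_lambda the rows 1, ..., n
are forced, so that these upper rows contribute the partition function of
w_lambda. *)

(** * Power series *)

(** The rule for repeated crossings refers to the history of two pipes. On a cut read from west to
    east, two pipes have crossed exactly when their labels stand in decreasing order, so sorting the
    labels at each crossing produces the same labelling; this is what makes the model local. The
    weights depend on [1 - x] and [1 / (1 - a)] only through their product, so the R-matrix of two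
    rows involves nothing but the ratio of their parameters and passes through every column. The
    empty tile has weight [- ominus x a], hence the recursion changes sign with each unit of length;
    for [w_lambda] only the parity of the length enters, and it is that of the number of boxes. The
    region has [n] nonpositive columns because each of its [n] rows can set at most one more
    nonpositive pipe in motion, starting from the right. The shape [lambda D] is made so that
    [w_lambda] sends the label of each pipe leaving north to its column; this ties the upper rows to
    the square of [w_lambda]. The expansion is an identity for every large enough finite square, and
    the limit is taken term by term at the end. *)

Lemma scoef0 m : coef 0 m = 0.
Proof. by []. Qed.

Lemma scoefD f g m : coef (f + g) m = coef f m + coef g m.
Proof. by []. Qed.

Lemma scoefB f g m : coef (f - g) m = coef f m - coef g m.
Proof. by []. Qed.

Lemma scoefM f g m :
  coef (f * g) m = \sum_(k <- submonoms m) coef f k * coef g (m `\` k)%mset.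
Proof. by []. Qed.

Lemma coef_svarM v f (m : {mset var}%mset) :
  coef (svar v * f) m = if v \in m then coef f (m `\ v)%mset else 0.
Proof.
rewrite scoefM; case: ifP => vm.
  rewrite (bigD1_seq ([mset v]%mset : monom)) ?submonoms_uniq //=; last first.
    by rewrite mem_submonoms msub1set.
  by rewrite eqxx mul1r big1 ?addr0 // => k /negPf ->; rewrite mul0r.
rewrite big_seq big1 // => k; rewrite mem_submonoms /= => km.
case: eqP => [e|_]; last by rewrite mul0r.
by move: km; rewrite e msub1set vm.
Qed.

(** The geometric series, inverse of [1 - svar v]. It makes the divisions by [1 - a_j] explicit and,
    for an x-variable, supplies the ratio of two row parameters. *)
Definition geom (v : var) : series :=
  Series (fun m => (all (pred1 v) (enum_mset m))%:R).

Lemma coef_geom v (m : {mset var}%mset) :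
  coef (geom v) m = (all (pred1 v) (enum_mset m))%:R.
Proof. by []. Qed.

(* Stated for an arbitrary ring, as are several identities below: rewriting
   with ring laws in [series] makes unification compute with multisets. *)
Lemma mul1B (R : pzRingType) (a b : R) : (1 - a) * b = b - a * b.
Proof. by rewrite mulrBl mul1r. Qed.

Lemma geomP v : (1 - svar v) * geom v = 1.
Proof.
rewrite mul1B; apply: seriesP => m; rewrite scoefB (coef_svarM v (geom v)) !coef_geom.
have memE (k : {mset var}%mset) u : (u \in enum_mset k) = (u \in k) by [].
have oneE : coef 1 m = (m == mset0)%:R by [].
rewrite oneE /=; case: ifPn => vm.
  have -> : all (pred1 v) (enum_mset m) = all (pred1 v) (enum_mset (m `\ v)%mset).
    apply/allP/allP => h u; rewrite memE => um.
      by apply: h; rewrite memE; move: um; rewrite !in_mset msetE2; lia.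
    case: (eqVneq u v) => [->|nuv] /=; first by rewrite eqxx.
    by apply: h; rewrite memE; move: um; rewrite !in_mset msetE2 msetnE (negPf nuv) subn0.
  rewrite subrr; case: eqP => // e.
  by move: vm; rewrite e in_mset0.
rewrite subr0; congr ((nat_of_bool _)%:R).
apply/allP/eqP => [h|->].
  apply/msetP => u; rewrite mset0E; apply/eqP; rewrite -[_ == _]negbK -lt0n.
  apply/negP => um; have /h /= /eqP uv : u \in enum_mset m by rewrite memE in_mset.
  by move: vm; rewrite -uv in_mset um.
by move=> u; rewrite memE in_mset0.
Qed.

(** Comparing coefficients replaces one [v] of a monomial by one [u] without changing the
    coefficient of [q], and the coefficient is 0 once no [v] is left. This is the regularity that
    makes the quotient in [tpi] unique. *)
Lemma svarB_reg (u v : var) (q : series) :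
  u != v -> (svar u - svar v) * q = 0 -> q = 0.
Proof.
rewrite mulrBl => uv /subr0_eq e; apply: seriesP => m; rewrite scoef0.
have ce (k : {mset var}%mset) : coef q k =
    if v \in k then coef q ((u +` k) `\ v)%mset else 0.
  have := etrans (esym (coef_svarM u q (u +` k)%mset))
    (etrans (congr1 (fun f => coef f (u +` k)%mset) e) (coef_svarM v q _)).
  by rewrite msetD1K !in_mset1D eqxx /= eq_sym (negPf uv).
move: e ce => _ ce; have [d] := ubnP (m v); elim: d m => // d IH m md; rewrite ce.
case: ifP => // vm; apply: IH; move: vm md.
rewrite in_mset msetB1E mset1DE eqxx eq_sym (negPf uv) add0n.
by move: (m v) => c; lia.
Qed.

Lemma sdiv_eq (f g q : series) :
  (forall r, g * r = 0 -> r = 0) -> g * q = f -> sdiv f g = q.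
Proof.
move=> reg e; rewrite /sdiv; apply: xget_unique => // r er.
apply/eqP; rewrite -subr_eq0; apply/eqP/reg.
by rewrite mulrBr er e subrr.
Qed.

Lemma subr_svar_reg v r : (1 - svar v) * r = 0 -> r = 0.
Proof.
by move=> e; rewrite -[r]mul1r -(geomP v) mulrAC e mul0r.
Qed.

Lemma ominusE x v : ominus x (svar v) = (x - svar v) * geom v.
Proof.
apply: sdiv_eq => [r|]; first exact: subr_svar_reg.
by rewrite mulrCA geomP mulr1.
Qed.

(** The elbow weight splits into a row factor and a column factor; [cell] is built on this form. *)
Lemma ominusC x v : 1 - ominus x (svar v) = (1 - x) * geom v.
Proof. by rewrite ominusE -{1}(geomP v); ring. Qed.

Lemma ominusN x v : - ominus x (svar v) = (1 - x) * geom v - 1.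
Proof. by rewrite -ominusC; ring. Qed.

Section Rename.
Variables sigma tau : var -> var.
Hypotheses (st : cancel sigma tau) (ts : cancel tau sigma).

Let ren (m : {mset var}%mset) : {mset var}%mset :=
  seq_mset [seq tau v | v <- enum_mset m].

Let renE m u : ren m u = m (sigma u).
Proof.
rewrite mset_seqE count_map -count_mem_mset; apply: eq_count => z /=.
exact: can2_eq ts st _ _.
Qed.

Let ren_inj : injective ren.
Proof.
by move=> m k e; apply/msetP => u; rewrite -[u]ts -!renE e.
Qed.

Let renB m k : ren (m `\` k)%mset = (ren m `\` ren k)%mset.
Proof. by apply/msetP => u; rewrite !(msetE2, renE). Qed.

Let ren_sub m k : (ren k `<=` ren m)%mset = (k `<=` m)%mset.
Proof.
apply/msubsetP/msubsetP => h u; last by rewrite !renE.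
by rewrite -[u]ts -!renE.
Qed.

Let ren_submonoms m :
  perm_eq [seq ren k : monom | k <- submonoms m] (submonoms (ren m)).
Proof.
apply: uniq_perm; rewrite ?submonoms_uniq ?map_inj_uniq ?submonoms_uniq //.
move=> k; rewrite mem_submonoms; apply/mapP/idP => [[l]|h].
  by rewrite mem_submonoms => lm ->; rewrite ren_sub.
have e : k = ren (seq_mset [seq sigma v | v <- enum_mset k]).
  apply/msetP => u; rewrite renE mset_seqE count_map -count_mem_mset.
  by apply: eq_count => z /=; rewrite (can_eq st).
by exists (seq_mset [seq sigma v | v <- enum_mset k]);
  rewrite // mem_submonoms -ren_sub -e.
Qed.

Lemma renameB : {morph rename tau : f g / f - g}.
Proof. by move=> f g; apply: seriesP. Qed.

Lemma renameM : {morph rename tau : f g / f * g}.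
Proof.
move=> f g; apply: seriesP => m; rewrite scoefM /= -/(ren m).
rewrite -(perm_big _ (ren_submonoms m)) /= big_map.
by apply: eq_bigr => k _; rewrite -renB.
Qed.

Lemma rename1 : rename tau 1 = 1.
Proof.
apply: seriesP => m /=; congr ((nat_of_bool _)%:R).
have r0 : ren mset0 = mset0 by apply/msetP => u; rewrite renE !mset0E.
by rewrite -/(ren m) -{1}r0 (inj_eq ren_inj).
Qed.

End Rename.

Section Limits.

Definition cvg_minfty (u : int -> series) (l : series) : Prop :=
  forall m, exists p0 : int, forall p, p <= p0 -> coef (u p) m = coef l m.

Lemma lim_minftyE u l : cvg_minfty u l -> lim_minfty u = l.
Proof.
move=> ul; apply: seriesP => m /=; case: (ul m) => p0 hp.
apply: xget_unique; first by exists p0.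
move=> c [p1 h]; rewrite -(h (Num.min p0 p1)); last by rewrite ge_min lexx orbT.
by rewrite hp // ge_min lexx.
Qed.

Lemma cvg_minftyM f u l : cvg_minfty u l -> cvg_minfty (fun p => f * u p) (f * l).
Proof.
move=> ul m; suff [p hp] : exists p : int, forall q, q <= p ->
    forall k, k \in submonoms m -> coef (u q) (m `\` k)%mset = coef l (m `\` k)%mset.
  exists p => q /hp h; rewrite !scoefM big_seq [RHS]big_seq.
  by apply: eq_bigr => k /h ->.
elim: (submonoms m) => [|k s [p IH]]; first by exists 0.
case: (ul (m `\` k)%mset) => p' hp'; exists (Num.min p p') => q.
rewrite le_min => /andP[/IH h /hp' h'] j; rewrite in_cons => /orP[/eqP->|/h] //.
Qed.

Lemma cvg_minfty_sum (I : Type) (s : seq I) (P : pred I) (u : I -> int -> series) l :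
  (forall i, P i -> cvg_minfty (u i) (l i)) ->
  cvg_minfty (fun p => \sum_(i <- s | P i) u i p) (\sum_(i <- s | P i) l i).
Proof.
move=> h; elim: s => [|i s IH] m.
  by exists 0 => p _; rewrite !big_nil.
have [p hp] := IH m; case Pi : (P i); last first.
  by exists p => q /hp; rewrite !big_cons Pi.
have [p' hp'] := h i Pi m; exists (Num.min p p') => q.
by rewrite le_min !big_cons Pi !scoefD => /andP[/hp-> /hp'->].
Qed.

Lemma cvg_minfty_eq u v l (p0 : int) :
  (forall p, p <= p0 -> u p = v p) -> cvg_minfty u l -> cvg_minfty v l.
Proof.
move=> uv ul m; case: (ul m) => p hp; exists (Num.min p p0) => q.
by rewrite le_min => /andP[/hp <- /uv ->].
Qed.

Lemma cvg_minfty_stable u (p0 : monom -> int) :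
  (forall m p, p <= p0 m -> coef (u (p - 1)) m = coef (u p) m) ->
  exists l, cvg_minfty u l.
Proof.
move=> h; exists (Series (fun m => coef (u (p0 m)) m)) => m; exists (p0 m) => p /= pp.
have -> : p = p0 m - (`|p0 m - p|%N)%:Z by lia.
elim: `|_|%N => [|d IH]; first by rewrite subr0.
by rewrite -IH -(h m (p0 m - d%:Z)); [congr (coef (u _) m)|]; lia.
Qed.

End Limits.

(** * Length and inversions *)

Lemma s_K i : involutive (s_ i).
Proof. by move=> k; rewrite /s_; do ![case: ifP]; lia. Qed.

Lemma s_lt i a b : a < b -> (a, b) != (i, i + 1) -> s_ i a < s_ i b.
Proof.
move=> ab; rewrite xpair_eqE negb_and => /orP h.
by rewrite /s_; do ![case: ifP => /eqP ?]; move: h; lia.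
Qed.

Lemma s_bij i : bijective (s_ i).
Proof. exact: inv_bij (s_K i). Qed.

Lemma word_perm_rcons u i : word_perm (rcons u i) = word_perm u \o s_ i.
Proof. by elim: u => [|j u IH] //=; rewrite IH. Qed.

Lemma word_perm_cat u v : word_perm (u ++ v) = word_perm u \o word_perm v.
Proof. by elim: u => [|j u IH] //=; rewrite IH. Qed.

Lemma word_perm_bij u : bijective (word_perm u).
Proof.
elim: u => [|i u IH] /=; first by exists id.
exact: bij_comp (s_bij i) IH.
Qed.

Lemma in_S_range n w i : in_S n w -> 1 <= i <= n%:Z -> 1 <= w i <= n%:Z.
Proof.
move=> [/bij_inj winj wid] hi; apply: contraT => h.
by have e := winj _ _ (wid _ h); rewrite e hi in h.
Qed.

Lemma in_S_s n w i : in_S n w -> 1 <= i < n%:Z -> in_S n (w \o s_ i).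
Proof.
move=> [wbij wid] hi; split; first exact: bij_comp wbij (s_bij i).
move=> j hj; rewrite /= -[RHS]wid //; congr w; rewrite /s_.
by do ![case: eqP]; lia.
Qed.

(** Climbing from 1 gives [k <= w k], descending from [n] gives [w k <= k]. *)
Lemma in_S_incr n w : in_S n w ->
  (forall i, 1 <= i < n%:Z -> w i < w (i + 1)) -> w =1 id.
Proof.
move=> wS winc i; have [wbij wid] := wS.
case: (boolP (1 <= i <= n%:Z)) => hi; last exact: wid.
have lo (k : nat) : (k < n)%N -> k.+1%:Z <= w k.+1%:Z.
  elim: k => [|k IH] kn; first by have := in_S_range _ _ 1%:Z wS; lia.
  have := winc k.+1%:Z; have := IH (ltnW kn).
  have -> : k.+1%:Z + 1 = k.+2%:Z by lia.
  lia.
have hi' (k : nat) : (k < n)%N -> w (n%:Z - k%:Z) <= n%:Z - k%:Z.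
  elim: k => [|k IH] kn; first by rewrite subr0; have := in_S_range _ _ n%:Z wS; lia.
  have := winc (n%:Z - k.+1%:Z); have := IH (ltnW kn).
  have -> : n%:Z - k.+1%:Z + 1 = n%:Z - k%:Z by lia.
  lia.
have := lo (`|i - 1|%N); have := hi' (`|n%:Z - i|%N).
have -> : (`|i - 1|%N).+1%:Z = i by lia.
have -> : n%:Z - (`|n%:Z - i|%N)%:Z = i by lia.
lia.
Qed.

Lemma w0_in_S n : in_S n (w0 n).
Proof.
have K : involutive (w0 n) by move=> i; rewrite /w0; do ![case: ifP]; lia.
by split; [exact: inv_bij K | move=> i /negPf h; rewrite /w0 h].
Qed.

Lemma in_S_decr n w : in_S n w ->
  (forall i, 1 <= i < n%:Z -> w (i + 1) < w i) -> w =1 w0 n.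
Proof.
move=> wS wdec i; have K : involutive (w0 n).
  by move=> j; rewrite /w0; do ![case: ifP]; lia.
rewrite -[LHS]K; congr (w0 n _); apply: (in_S_incr n (w0 n \o w)).
  split; first exact: bij_comp (inv_bij K) wS.1.
  by move=> j hj; rewrite /= wS.2 // (w0_in_S n).2.
move=> j hj; have := wdec j hj; have := in_S_range _ _ j wS.
by have := in_S_range _ _ (j + 1) wS; rewrite /= /w0; do ![case: ifP]; lia.
Qed.

Definition invs (n : nat) (w : int -> int) : seq (int * int) :=
  [seq ab <- [seq (a%:Z, b%:Z) | a <- iota 1 n, b <- iota 1 n] |
     (ab.1 < ab.2) && (w ab.2 < w ab.1)].

Lemma mem_invs n w a b :
  ((a, b) \in invs n w) = [&& 1 <= a, a < b, b <= n%:Z & w b < w a].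
Proof.
rewrite mem_filter /=; case ab: (a < b) => /=; last by rewrite andbF.
case: (w b < w a); rewrite ?andbF //= !andbT.
apply/allpairsP/andP => [[[i j] [/=]]|[a1 bn]].
  by rewrite !mem_iota => hi hj [-> ->]; lia.
exists (`|a|%N, `|b|%N); rewrite !mem_iota /=; split; last congr pair; lia.
Qed.

Lemma invs_uniq n w : uniq (invs n w).
Proof.
apply: filter_uniq; apply: allpairs_uniq; rewrite ?iota_uniq //.
by move=> [a b] [c d] _ _ [-> ->].
Qed.

(** Exchanging the positions [i] and [i + 1] carries the inversions of [w \o s_ i] bijectively to
    those of [w] other than [(i, i + 1)]. *)
Lemma size_invs_s n (w : int -> int) (i : int) : 1 <= i < n%:Z -> w (i + 1) < w i ->
  size (invs n w) = (size (invs n (w \o s_ i))).+1.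
Proof.
move=> hi wi; pose f (ab : int * int) := (s_ i ab.1, s_ i ab.2).
have fK : involutive f by case=> a b; rewrite /f /= !s_K.
transitivity (size ((i, i + 1) :: map f (invs n (w \o s_ i)))); last by rewrite /= size_map.
apply: perm_size.
apply: uniq_perm; rewrite ?invs_uniq //= ?(map_inj_uniq (inv_inj fK)) ?invs_uniq ?andbT.
  apply/mapP => -[[a b]]; rewrite mem_invs => /and4P[_ ab _ _] [].
  by rewrite /s_; do ![case: eqP]; lia.
have memf x l : (x \in map f l) = (f x \in l).
  by rewrite -{1}[x]fK (mem_map (inv_inj fK)).
move=> [a b]; rewrite in_cons mem_invs memf mem_invs /= !s_K; case: (eqVneq (a, b) (i, i + 1)) => [[-> ->]|ne] /=.
  by rewrite wi; lia.
case: (eqVneq (a, b) (i + 1, i)) => [[-> ->]|ne']; first by rewrite /s_ !eqxx; lia.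
case: (w b < w a); rewrite ?andbF // !andbT.
have := s_lt i a b; have := s_lt i b a; rewrite (negPf ne) (eq_sym (b, a)).
have -> : ((i, i + 1) == (b, a)) = ((a, b) == (i + 1, i)).
  by rewrite !xpair_eqE andbC; congr andb; apply: eq_sym.
rewrite (negPf ne'); move: ne ne'; rewrite /s_ !xpair_eqE.
by do ![case: eqP]; lia.
Qed.

(** Removing the last letter [i] of a word loses at most the inversion [(i, i + 1)]. The list [P] is
    arbitrary because [len] minimises over all words, also those with letters outside
    [[1, n - 1]]. *)
Lemma invs_word u w (P : seq (int * int)) : word_perm u =1 w -> uniq P ->
  {in P, forall ab, ab.1 < ab.2 /\ w ab.2 < w ab.1} -> (size P <= size u)%N.
Proof.
elim/last_ind: u w P => [|u i IH] w P uw Pu Pi.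
  case: P Pi {Pu} => // -[a b] P /(_ _ (mem_head _ _)) [/= ab].
  by rewrite -!uw /word_perm /=; move: ab; lia.
pose f (ab : int * int) := (s_ i ab.1, s_ i ab.2).
have fK : involutive f by case=> a b; rewrite /f /= !s_K.
have : (size [seq f ab | ab <- rem (i, i + 1)%R P] <= size u)%N.
  apply: (IH (word_perm u)) => //.
    by rewrite (map_inj_uniq (inv_inj fK)) rem_uniq.
  move=> _ /mapP[[a b] + ->]; rewrite mem_rem_uniq // inE /= => /andP[ne ab].
  have [/= lt] := Pi _ ab; rewrite -!uw word_perm_rcons /=.
  by split; first exact: s_lt.
rewrite size_map size_rcons; case: (boolP ((i, i + 1) \in P)) => h.
  by rewrite size_rem //; case: (size P).
by rewrite rem_id // => /leqW.
Qed.

Lemma invs_word_ex n w : in_S n w ->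
  exists2 u, size u = size (invs n w) & word_perm u =1 w.
Proof.
move: {2}(size (invs n w)) (erefl (size (invs n w))) => d.
elim: d w => [|d IH] w dw wS.
  exists [::]; first by rewrite dw.
  move=> k; apply/esym; apply: (in_S_incr n w) => // i hi.
  have /negP : (i, i + 1) \notin invs n w by rewrite (size0nil dw).
  have : w i != w (i + 1) by rewrite (inj_eq (bij_inj wS.1)); lia.
  by rewrite mem_invs; lia.
have [i hi wi] : exists2 i, 1 <= i < n%:Z & w (i + 1) < w i.
  apply: contrapT => no; have : invs n w = [::]; last by move=> e; rewrite e in dw.
  have wid : w =1 id.
    apply: (in_S_incr n w) => // i hi; rewrite ltNge; apply/negP => wi; apply: no.
    exists i => //; rewrite lt_neqAle wi andbT (inj_eq (bij_inj wS.1)); lia.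
  apply: (@size0nil _ _); apply/eqP; rewrite size_eq0; apply/eqP.
  case e : (invs n w) => [|[a b] l] //; have := mem_head (a, b) l.
  by rewrite -e mem_invs !wid; lia.
have dw' : size (invs n (w \o s_ i)) = d by move: dw; rewrite (size_invs_s n w i) // => -[].
have [u su uw] := IH _ dw' (in_S_s _ _ _ wS hi).
exists (rcons u i); first by rewrite size_rcons su dw dw'.
by move=> k; rewrite word_perm_rcons /= uw /= s_K.
Qed.

Lemma len_invs n w : in_S n w -> len w = size (invs n w).
Proof.
move=> wS; have lb u : word_perm u =1 w -> (size (invs n w) <= size u)%N.
  move=> uw; apply: (invs_word u w) => //; first exact: invs_uniq.
  by move=> [a b]; rewrite mem_invs => /and4P[].
have [u su uw] := invs_word_ex _ _ wS.
rewrite /len; apply: xget_unique; first by split=> //; exists u.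
move=> k [[v sv vw] kmin]; apply/eqP; rewrite eqn_leq -{1}su kmin //=.
by rewrite -sv lb.
Qed.

Lemma len_s n w i : in_S n w -> 1 <= i < n%:Z ->
  if w i < w (i + 1) then len (w \o s_ i) = (len w).+1
  else len w = (len (w \o s_ i)).+1.
Proof.
move=> wS hi; have wsS := in_S_s _ _ _ wS hi; rewrite !(len_invs n) //.
case: ifP => wi; last first.
  apply: size_invs_s => //.
  by rewrite lt_neqAle leNgt wi andbT (inj_eq (bij_inj wS.1)); lia.
rewrite (size_invs_s n (w \o s_ i) i) //=.
  by congr (size (invs n _)).+1; apply/funext => k /=; rewrite s_K.
have -> : s_ i (i + 1) = i by rewrite /s_; do ![case: eqP]; lia.
by have -> : s_ i i = i + 1 by rewrite /s_ eqxx.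
Qed.

Lemma ascent_len n w i : in_S n w -> 1 <= i < n%:Z ->
  (len w < len (w \o s_ i))%N = (w i < w (i + 1)).
Proof. by move=> wS hi; have := len_s _ _ _ wS hi; case: ifP => _ ->; lia. Qed.

Lemma sign_len_s n w i : in_S n w -> 1 <= i < n%:Z ->
  odd (len (w \o s_ i)) = ~~ odd (len w).
Proof. by move=> wS hi; have := len_s _ _ _ wS hi; case: ifP => _ -> /=; rewrite ?negbK. Qed.

Lemma in_S_word n u : all (fun i => 1 <= i < n%:Z) u -> in_S n (word_perm u).
Proof.
elim/last_ind: u => [|u i IH]; first by split; [exists id|].
by rewrite all_rcons word_perm_rcons => /andP[hi /IH uS]; apply: in_S_s.
Qed.

Lemma odd_len_word n u : all (fun i => 1 <= i < n%:Z) u ->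
  odd (len (word_perm u)) = odd (size u).
Proof.
elim/last_ind: u => [|u i IH] /=.
  move=> _; rewrite (len_invs 0) //; by split; [exists id|].
rewrite all_rcons word_perm_rcons size_rcons => /andP[hi us].
by rewrite (sign_len_s n) ?IH //; apply: in_S_word.
Qed.

Lemma word_perm_shift u d k :
  word_perm [seq i + d | i <- u] k = word_perm u (k - d) + d.
Proof.
elim: u k => [|i u IH] k /=; first by rewrite subrK.
rewrite IH; move: (word_perm u (k - d)) => j; rewrite /s_.
by do ![case: eqP]; lia.
Qed.

Lemma gammaK d w : gamma (- d) (gamma d w) = w.
Proof. by apply/funext => k; rewrite /gamma opprK !addrK. Qed.

Lemma len_gamma d w : len (gamma d w) = len w.
Proof.
have shift_word e v u : word_perm u =1 v -> word_perm [seq i + e | i <- u] =1 gamma e v.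
  by move=> uv k; rewrite word_perm_shift uv.
rewrite /len; congr xget; apply/funext => k; apply/propext.
split=> -[[u su uw] kmin]; split.
- exists [seq i - d | i <- u]; first by rewrite size_map.
  by rewrite -(gammaK d w); apply: shift_word.
- by move=> v vw; rewrite -(size_map (fun i => i + d)); apply/kmin/shift_word.
- exists [seq i + d | i <- u]; first by rewrite size_map.
  exact: shift_word.
- move=> v vw; rewrite -(size_map (fun i => i - d)); apply: kmin.
  by rewrite -(gammaK d w); apply: shift_word.
Qed.

(** * The lattice model *)

Section Lattice.
Variable R : comNzRingType.
Implicit Types (X Y B : R) (h e : option int) (Bs : seq R) (s l : seq (option int)).
Implicit Types K : seq (option int) -> R.

(* Sum over the tiles with west label [W] and south label [T], where [X] is
   1 - x and [B] is 1 / (1 - a), so that the weights of the empty tile and of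
   the NW elbow are [X * B - 1] and [X * B]. Pipes whose labels arrive in
   decreasing order have already crossed, which accounts for the crossing rule. *)
Definition cell X B (W T : option int) (f : option int -> option int -> R) : R :=
  match W, T with
  | None, None => (X * B - 1) * f None None
  | None, Some q => f (Some q) None + f None (Some q)
  | Some p, None => f (Some p) None + X * B * f None (Some p)
  | Some p, Some q => f (Some (Num.min p q)) (Some (Num.max p q))
  end.

(* [h] and [e] are the west and east labels of the row, [s] its south labels;
   the continuation [K] receives the north labels. *)
Fixpoint row_sum X e h Bs s K {struct Bs} : R :=
  match Bs, s with
  | B :: Bs', T :: s' =>
      cell X B h T (fun E N => row_sum X e E Bs' s' (fun l => K (N :: l)))
  | _, _ => if h == e then K [::] else 0
  end.

(* The rows are listed from top to bottom, so the head is filled last. *)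
Fixpoint grid_sum (rows : seq (R * option int)) Bs K s : R :=
  if rows is (X, e) :: rows' then
    grid_sum rows' Bs (fun l => row_sum X e None Bs l K) s
  else K s.

Lemma cell_lin X B W T a f g :
  cell X B W T (fun E N => a * f E N + g E N) = a * cell X B W T f + cell X B W T g.
Proof. by case: W T => [p|] [q|] /=; ring. Qed.

Lemma row_sum_lin X e h Bs s a K K' :
  row_sum X e h Bs s (fun l => a * K l + K' l) =
  a * row_sum X e h Bs s K + row_sum X e h Bs s K'.
Proof.
elim: Bs s h K K' => [|B Bs IH] [|T s] h K K' /=; try by case: ifP; rewrite ?mulr0 ?addr0.
by rewrite -cell_lin; congr cell; apply/funext => E; apply/funext => N; rewrite IH.
Qed.

Lemma row_sum0 X e h Bs s : row_sum X e h Bs s (fun=> 0) = 0.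
Proof.
elim: Bs s h => [|B Bs IH] [|T s] h /=; rewrite ?if_same //.
by case: h T => [p|] [q|] /=; rewrite !IH ?mulr0 ?addr0.
Qed.

Lemma row_sumD X e h Bs s K K' :
  row_sum X e h Bs s (fun l => K l + K' l) =
  row_sum X e h Bs s K + row_sum X e h Bs s K'.
Proof.
rewrite -[row_sum X e h Bs s K]mul1r -row_sum_lin.
by congr row_sum; apply/funext => l; rewrite mul1r.
Qed.

Lemma row_sumZ X e h Bs s a K :
  row_sum X e h Bs s (fun l => a * K l) = a * row_sum X e h Bs s K.
Proof.
rewrite -[RHS]addr0 -(row_sum0 X e h Bs s) -row_sum_lin.
by congr row_sum; apply/funext => l; rewrite addr0.
Qed.

(** A cell of the upper row commutes with the rest of the lower row, which lets two rows be filled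
    column by column. *)
Lemma row_sum_cell X e h Bs s Y B W T (g : option int -> option int -> seq (option int) -> R) :
  row_sum X e h Bs s (fun m => cell Y B W T (fun E N => g E N m)) =
  cell Y B W T (fun E N => row_sum X e h Bs s (g E N)).
Proof. by case: W T => [p|] [q|] /=; rewrite ?row_sumD ?row_sumZ. Qed.

Lemma grid_sum_lin rows Bs s a K K' :
  grid_sum rows Bs (fun l => a * K l + K' l) s =
  a * grid_sum rows Bs K s + grid_sum rows Bs K' s.
Proof.
elim: rows K K' => [|[X e] rows IH] K K' //=.
by rewrite -IH; congr grid_sum; apply/funext => l; rewrite row_sum_lin.
Qed.

Lemma grid_sum0 rows Bs s : grid_sum rows Bs (fun=> 0) s = 0.
Proof.
elim: rows => [|[X e] rows IH] //=; rewrite -[RHS]IH.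
by congr grid_sum; apply/funext => l; rewrite row_sum0.
Qed.

Lemma grid_sum_cat rows1 rows2 Bs K s :
  grid_sum (rows1 ++ rows2) Bs K s = grid_sum rows2 Bs (grid_sum rows1 Bs K) s.
Proof. by elim: rows1 K => [|[X e] rows1 IH] K //=; rewrite IH. Qed.

Lemma grid_sum_rcons rows X e Bs K s :
  grid_sum (rcons rows (X, e)) Bs K s = row_sum X e None Bs s (grid_sum rows Bs K).
Proof. by rewrite -cats1 grid_sum_cat. Qed.

Section YangBaxter.

(** Index 1 is the upper row, index 2 the lower one, which is filled first. *)
Let two_rows X Y e1 e2 h1 h2 Bs s K :=
  row_sum Y e2 h2 Bs s (fun m => row_sum X e1 h1 Bs m K).

Let two_rows_cons X Y e1 e2 h1 h2 B Bs T s K :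
  two_rows X Y e1 e2 h1 h2 (B :: Bs) (T :: s) K =
  cell Y B h2 T (fun E2 M => cell X B h1 M (fun E1 N =>
    two_rows X Y e1 e2 E1 E2 Bs s (fun l => K (N :: l)))).
Proof.
rewrite /two_rows /=; congr cell; apply/funext => E2; apply/funext => M.
by rewrite row_sum_cell.
Qed.

Variables (p q : int) (r Y : R).
Hypothesis pq : p < q.

(** [F] carries the R-matrix at the east end, while [G] has the two row parameters exchanged.
    Relating them for arbitrary west labels is the form that survives an induction on the
    columns. *)
Let F h1 h2 Bs s K :=
  (1 - r) * two_rows (r * Y) Y (Some p) (Some q) h1 h2 Bs s K +
  two_rows (r * Y) Y (Some q) (Some p) h1 h2 Bs s K.

Let G h1 h2 Bs s K := r * two_rows Y (r * Y) (Some q) (Some p) h1 h2 Bs s K.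

Let F_cons h1 h2 B Bs T s K : F h1 h2 (B :: Bs) (T :: s) K =
  cell Y B h2 T (fun E2 M => cell (r * Y) B h1 M (fun E1 N =>
    F E1 E2 Bs s (fun l => K (N :: l)))).
Proof.
rewrite /F !two_rows_cons -cell_lin; congr cell.
by apply/funext => E2; apply/funext => M; rewrite -cell_lin.
Qed.

Let G_cons h1 h2 B Bs T s K : G h1 h2 (B :: Bs) (T :: s) K =
  cell (r * Y) B h2 T (fun E2 M => cell Y B h1 M (fun E1 N =>
    G E1 E2 Bs s (fun l => K (N :: l)))).
Proof.
have cellZ X b W U f : cell X b W U (fun E N => r * f E N) = r * cell X b W U f.
  by case: W U => [a|] [c|] /=; ring.
rewrite /G !two_rows_cons -cellZ; congr cell.
by apply/funext => E2; apply/funext => M; rewrite -cellZ.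
Qed.

(* The R-matrix, with [None] as the largest label. *)
Let yang_baxter_col h1 h2 Bs s K :
  G h1 h2 Bs s K =
  match h1, h2 with
  | None, None => F None None Bs s K
  | None, Some _ => r * F h1 h2 Bs s K
  | Some _, None => F h1 h2 Bs s K + (r - 1) * F h2 h1 Bs s K
  | Some a, Some b => if b <= a then r * F h1 h2 Bs s K
                      else F h1 h2 Bs s K + (r - 1) * F h2 h1 Bs s K
  end.
Proof.
have NS (c : int) : (None == Some c) = false by [].
have SS (c d : int) : (Some c == Some d) = (c == d) by [].
elim: Bs s h1 h2 K => [|B Bs IH] s h1 h2 K; last case: s => [|T s].
(* With no column left, the west labels are compared directly with the exits, and the identity
   depends only on the relative order of [a], [b], [p], [q]. *)
1,2: rewrite /G /F /two_rows /=.
1,2: case: h1 h2 => [a|] [b|]; rewrite ?NS ?if_same ?SS ?mulr0 ?addr0 ?mulr0 ?addr0 //.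
1,2: have [] := ltgtP a b => ab; have [] := ltgtP a p => ap;
  have [] := ltgtP b p => bp; have [] := ltgtP a q => aq;
  have [] := ltgtP b q => bq; subst; try (exfalso; lia); rewrite ?lexx; ring.
rewrite !F_cons G_cons.
case: h1 h2 T => [a|] [b|] [c|] /=; rewrite !IH //=; try ring.
- have [ab|ba|ab] := ltgtP a b; have [bc|cb|bc] := ltgtP b c;
    have [ac|ca|ac] := ltgtP a c; subst; try (exfalso; lia); rewrite ?(minxx, maxxx);
    repeat match goal with H : is_true (?x < ?y) |- _ => progress
      rewrite ?(min_l (ltW H)) ?(min_r (ltW H)) ?(max_l (ltW H)) ?(max_r (ltW H))
        ?(ltW H) ?(lt_geF H) end; rewrite ?lexx ?(minxx, maxxx); ring.
- by have [ab|ba|ab] := ltgtP a b; subst; rewrite ?lexx ?(minxx, maxxx) ?(ltW ab); ring.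
- by have [ab|ba|ab] := ltgtP a c; subst; rewrite ?lexx ?(minxx, maxxx) ?(ltW ab); ring.
- by have [bc|bc|bc] := ltgtP b c; subst; rewrite ?lexx ?(minxx, maxxx) ?(ltW bc) ?(lt_geF bc); ring.
Qed.

(** Both rows begin with an empty west edge, where the R-matrix acts as the identity. *)
Lemma yang_baxter Bs s K :
  (Y - r * Y) * row_sum Y (Some q) None Bs s (fun m => row_sum (r * Y) (Some p) None Bs m K) =
  r * Y * row_sum (r * Y) (Some p) None Bs s (fun m => row_sum Y (Some q) None Bs m K) -
  Y * row_sum Y (Some p) None Bs s (fun m => row_sum (r * Y) (Some q) None Bs m K).
Proof.
have := yang_baxter_col None None Bs s K; rewrite /G /F /two_rows => e.
by rewrite -[r * Y * _]mulrA [r * (Y * _)]mulrCA e; ring.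
Qed.

End YangBaxter.

End Lattice.

Lemma grid_sum_morph (R R' : comNzRingType) (phi : R -> R') :
  {morph phi : a b / a - b} -> {morph phi : a b / a * b} -> phi 1 = 1 ->
  forall rows Bs K s,
  phi (grid_sum R rows Bs K s) =
  grid_sum R' [seq (phi r.1, r.2) | r <- rows] [seq phi b | b <- Bs] (fun l => phi (K l)) s.
Proof.
move=> phiB phiM phi1.
have phi0 : phi 0 = 0 by rewrite -(subrr 0) phiB subrr.
have phiN b : phi (- b) = - phi b by rewrite -sub0r phiB phi0 sub0r.
have phiD a b : phi (a + b) = phi a + phi b by rewrite -[b in LHS]opprK phiB phiN opprK.
have row_morph X e h Bs s K : phi (row_sum R X e h Bs s K) =
    row_sum R' (phi X) e h [seq phi b | b <- Bs] s (fun l => phi (K l)).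
  elim: Bs s h K => [|B Bs IH] [|T s] h K /=; rewrite ?(fun_if phi) ?phi0 //.
  by case: h T => [p|] [q|] /=; rewrite !(phiD, phiN, phiM, phi1, IH).
elim=> [|[X e] rows IH] Bs K s //=; rewrite IH; congr grid_sum.
by apply/funext => l; rewrite row_morph.
Qed.

Section LatticeTheory.
Variable R : comNzRingType.
Implicit Types (X Y B : R) (h e : option int) (Bs : seq R) (s l : seq (option int)).
Implicit Types K : seq (option int) -> R.
Implicit Types rows : seq (R * option int).
Notation row_sum := (row_sum R).
Notation grid_sum := (grid_sum R).

Section Relabel.
Variable f : int -> int.
Hypothesis fmono : {mono f : x y / x <= y}.

Let f_eq : forall a b : option int, (omap f a == omap f b) = (a == b).
Proof.
by apply: inj_eq => -[a|] [b|] // [] /(inc_inj fmono) ->.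
Qed.

(** Cells only take minima and maxima of labels, so an order-preserving relabelling changes no
    weight. *)
Lemma row_sum_relabel X e h Bs s K :
  row_sum X (omap f e) (omap f h) Bs [seq omap f a | a <- s] K =
  row_sum X e h Bs s (fun l => K [seq omap f a | a <- l]).
Proof.
elim: Bs s h K => [|B Bs IH] [|T s] h K /=; rewrite ?f_eq //.
have fmin a b : Num.min (f a) (f b) = f (Num.min a b).
  by rewrite !minEle fmono; case: ifP.
have fmax a b : Num.max (f a) (f b) = f (Num.max a b).
  by rewrite !maxEle fmono; case: ifP.
case: h T => [p|] [q|] /=; rewrite ?fmin ?fmax.
- exact: (IH s (Some (Num.min p q))).
- by rewrite (IH s (Some p)) (IH s None).
- by rewrite (IH s (Some q)) (IH s None).
- by rewrite (IH s None).
Qed.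

Lemma grid_sum_relabel rows Bs s K :
  grid_sum [seq (r.1, omap f r.2) | r <- rows] Bs K [seq omap f a | a <- s] =
  grid_sum rows Bs (fun l => K [seq omap f a | a <- l]) s.
Proof.
elim: rows K => [|[X e] rows IH] K //=; rewrite IH; congr grid_sum.
by apply/funext => l; rewrite (row_sum_relabel X e None).
Qed.

End Relabel.

(* The labels met along a northwest-southeast cut change only at a crossing,
   where two neighbours get sorted into decreasing order; [P] is a property of
   cuts which is stable under such a move. *)
Lemma row_sum_cut (P : seq int -> Prop) X e :
  (forall u a b v, P (u ++ a :: b :: v) -> P (u ++ Num.max a b :: Num.min a b :: v)) ->
  forall Bs s h u K K', size s = size Bs -> P (u ++ pmap id (h :: s)) ->
  (forall l, size l = size s -> P (u ++ pmap id (l ++ [:: e])) -> K l = K' l) ->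
  row_sum X e h Bs s K = row_sum X e h Bs s K'.
Proof.
move=> Pmove; elim=> [|B Bs IH] [|T s] h u K K' //=.
  by move=> _ Pu KK; case: eqP => [he|] //; apply: KK; rewrite //= -he.
move=> [ss] Pu KK.
have next0 E : P (u ++ pmap id (E :: s)) ->
    row_sum X e E Bs s (fun l => K (None :: l)) = row_sum X e E Bs s (fun l => K' (None :: l)).
  by move=> PE; apply: (IH s E u) => // l sl Pl; apply: KK; rewrite //= sl.
have next1 E a : P (u ++ a :: pmap id (E :: s)) ->
    row_sum X e E Bs s (fun l => K (Some a :: l)) = row_sum X e E Bs s (fun l => K' (Some a :: l)).
  move=> PE; apply: (IH s E (rcons u a)) => // [|l sl Pl]; first by rewrite cat_rcons.
  by apply: KK; rewrite /= ?sl // -cat_rcons.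
case: h T Pu => [p|] [q|] /= Pu.
- by apply: next1; apply: Pmove.
- by rewrite next0 // next1.
- by rewrite next0 // next1.
- by rewrite next0.
Qed.

Lemma eq_row_sum X e h Bs s K K' : size s = size Bs ->
  (forall l, size l = size s -> K l = K' l) ->
  row_sum X e h Bs s K = row_sum X e h Bs s K'.
Proof. by move=> ss KK; apply: (row_sum_cut (fun=> True)) [::] _ _ _ _ _ => // l sl _; apply: KK. Qed.

Lemma eq_grid_sum rows Bs s K K' : size s = size Bs ->
  (forall l, size l = size s -> K l = K' l) ->
  grid_sum rows Bs K s = grid_sum rows Bs K' s.
Proof.
move=> ss; elim: rows K K' => [|[X e] rows IH] K K' KK /=; first exact: KK.
apply: IH => l sl; apply: eq_row_sum; first by rewrite sl.
by move=> l' sl'; apply: KK; rewrite sl'.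
Qed.

Lemma row_sum_cut0 (P : seq int -> Prop) X e Bs s h K :
  (forall u a b v, P (u ++ a :: b :: v) -> P (u ++ Num.max a b :: Num.min a b :: v)) ->
  size s = size Bs -> P (pmap id (h :: s)) ->
  (forall l, size l = size s -> P (pmap id l ++ pmap id [:: e]) -> K l = 0) ->
  row_sum X e h Bs s K = 0.
Proof.
move=> Pmove ss Ps K0; rewrite -(row_sum0 _ X e h Bs s).
apply: (row_sum_cut P _ _ Pmove _ _ _ [::]) => // l sl.
by rewrite pmap_cat; apply: K0.
Qed.

Lemma mem_cut_move (c : int) u a b v :
  (c \in u ++ Num.max a b :: Num.min a b :: v) = (c \in u ++ a :: b :: v).
Proof.
rewrite !mem_cat !in_cons; have [ab|ab|<-] := ltgtP a b => //.
by congr orb; rewrite orbCA.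
Qed.

Lemma row_sum_mem0 v X e Bs s h K :
  size s = size Bs -> v \in pmap id (h :: s) ->
  (forall l, size l = size s -> v \in pmap id l ++ pmap id [:: e] -> K l = 0) ->
  row_sum X e h Bs s K = 0.
Proof.
by apply: (row_sum_cut0 (fun u => v \in u)) => u a b w; rewrite mem_cut_move.
Qed.

Lemma row_sum_notin v X Bs s h K : size s = size Bs -> v \notin pmap id (h :: s) ->
  row_sum X (Some v) h Bs s K = 0.
Proof.
move=> ss vs; apply: (row_sum_cut0 (fun u => v \notin u)) => // [u a b w|l _].
  by rewrite mem_cut_move.
by rewrite /= mem_cat mem_head orbT.
Qed.

(** A label smaller than all those it meets takes the east edge at each crossing; were it to turn
    north, it could no longer leave at the east end. *)
Lemma row_sum_carry v X Bs s K : size s = size Bs ->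
  all (fun c => v < c) (pmap id s) ->
  row_sum X (Some v) (Some v) Bs s K = K s.
Proof.
elim: Bs s K => [|B Bs IH] [|[c|] s] K //=; first by rewrite eqxx.
- by move=> [ss] /andP[vc vs]; rewrite (min_l (ltW vc)) (max_r (ltW vc)) IH.
- move=> [ss] vs; rewrite IH // row_sum_notin ?mulr0 ?addr0 //=.
  by apply/negP => /(allP vs); rewrite ltxx.
Qed.

(** All south edges up to that of [v] are occupied, so the label moving east stays below [v] and
    pushes [v] north. *)
Lemma row_sum_blocked c v X Bs u s K :
  size ([seq Some k | k <- u] ++ Some v :: s) = size Bs ->
  c < v -> v \notin pmap id s ->
  row_sum X (Some v) (Some c) Bs ([seq Some k | k <- u] ++ Some v :: s) K = 0.
Proof.
elim: u Bs c K => [|k u IH] [|B Bs] c K //= [ss] cv vs.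
  rewrite (min_l (ltW cv)) row_sum_notin //= in_cons negb_or vs andbT.
  by rewrite gt_eqF.
by rewrite IH // gt_min cv.
Qed.

(** The only surviving filling: the pipes of [u] go straight up and [v] turns east, crossing all
    later pipes. All these tiles have weight 1. Fixed points, [w0] and Grassmannian permutations are
    evaluated by this lemma. *)
Lemma row_sum_forced v X Bs u s K :
  size ([seq Some k | k <- u] ++ Some v :: s) = size Bs ->
  all (fun c => c < v) u -> all (fun c => v < c) (pmap id s) ->
  row_sum X (Some v) None Bs ([seq Some k | k <- u] ++ Some v :: s) K =
  K ([seq Some k | k <- u] ++ None :: s).
Proof.
move=> + + vs; have vns : v \notin pmap id s.
  by apply/negP => /(allP vs); rewrite ltxx.
elim: u Bs K => [|k u IH] [|B Bs] K //= [ss].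
  by rewrite row_sum_carry // row_sum_notin // addr0.
by case/andP => kv uv; rewrite row_sum_blocked // add0r IH.
Qed.

(** Since a pipe leaves the row at the east, the last cell must be horizontal, with weight 1. *)
Lemma row_sum_last_None (e : int) X Bs B s h K : size s = size Bs ->
  row_sum X (Some e) h (rcons Bs B) (rcons s None) K =
  row_sum X (Some e) h Bs s (fun l => K (rcons l None)).
Proof.
elim: Bs s h K => [|B' Bs IH] [|T s] h K //=.
  by case: h => [p|] _ /=; rewrite ?mulr0 ?addr0.
by move=> [ss]; case: h T => [p|] [q|] /=; rewrite !IH.
Qed.

Lemma grid_sum_last_None rows Bs B s K : size s = size Bs ->
  all (fun r => isSome r.2) rows ->
  grid_sum rows (rcons Bs B) K (rcons s None) =
  grid_sum rows Bs (fun l => K (rcons l None)) s.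
Proof.
move=> ss; elim: rows K => [|[X [e|]] rows IH] K //= es.
rewrite IH //; apply: eq_grid_sum => // l sl.
by apply: row_sum_last_None; rewrite sl.
Qed.

Definition no_pipe s : R := (all (pred1 None) s)%:R.

Lemma row_sum_no_pipe k X Bs s : size s = size Bs ->
  row_sum X (Some k) (Some k) Bs s no_pipe = no_pipe s.
Proof.
have cons0 Y e h Cs t q : row_sum Y e h Cs t (fun l => no_pipe (Some q :: l)) = 0.
  exact: row_sum0.
elim: Bs s => [|B Bs IH] [|[q|] s] // ss; first by rewrite /= eqxx.
- exact: cons0.
- by rewrite /= cons0 mulr0 addr0; apply: IH; case: ss.
Qed.

Section ModEps.
Variable eps : R.

Let divis (a : R) := exists c, a = eps * c.

Let divis0 : divis 0. Proof. by exists 0; rewrite mulr0. Qed.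
Let divisD a b : divis a -> divis b -> divis (a + b).
Proof. by move=> [c ->] [d ->]; exists (c + d); rewrite mulrDr. Qed.
Let divisM a b : divis b -> divis (a * b).
Proof. by move=> [c ->]; exists (a * c); rewrite mulrCA. Qed.

Let divis_row X e h Bs s K : (forall l, divis (K l)) -> divis (row_sum X e h Bs s K).
Proof.
elim: Bs s h K => [|B Bs IH] [|T s] h K Kd /=; try by case: ifP.
by case: h T => [p|] [q|] /=; do ?[apply: divisD | apply: divisM | apply: IH => l].
Qed.

(** Once the pipe of the first column turns east, the column stays empty above it, so [K] receives
    an initial [None] and contributes a multiple of [eps]. The remaining term sends the pipe
    straight up. In the application [eps] is the weight of an empty corner. *)
Lemma grid_sum_mod_first k rows Bs B K K1 s :
  (forall l, exists c, K (None :: l) = eps * c) ->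
  (forall l, size l = size s -> exists c, K (Some k :: l) = K1 l + eps * c) ->
  size s = size Bs ->
  exists c, grid_sum rows (B :: Bs) K (Some k :: s) = grid_sum rows Bs K1 s + eps * c.
Proof.
move=> KN KS ss; elim: rows K K1 KN KS => [|[X e] rows IH] K K1 KN KS /=; first exact: KS.
apply: IH => l /=; first exact/divisM/divis_row.
(* The cofactors must form one function of the list, to serve as a continuation of [row_sum]; for
   lists of the wrong length nothing is claimed. *)
move=> sl; have /choice[c hc] : forall t, exists c, size t = size s ->
    K (Some k :: t) = K1 t + eps * c.
  move=> t; case: (eqVneq (size t) (size s)) => [/KS[c ec]|nt]; first by exists c.
  by exists 0 => /eqP; rewrite (negPf nt).
have [d hd] := divis_row X e (Some k) Bs l _ KN.
exists (d + row_sum X e None Bs l c); rewrite hd mulrDr addrCA; congr (_ + _).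
rewrite -row_sumZ -row_sumD; apply: eq_row_sum; first by rewrite sl.
by move=> t st; rewrite hc // st sl.
Qed.

End ModEps.

End LatticeTheory.

(** * Grothendieck series as partition functions *)

Section AdjacentRows.
Variable R : comNzRingType.
Implicit Types (X Y B : R) (h e : option int) (Bs : seq R) (s l : seq (option int)).
Implicit Types K : seq (option int) -> R.

Lemma grid_sum_yang_baxter (p q : int) (r X Y : R) rows1 rows2 Bs K s :
  p < q -> r * Y = X ->
  (Y - X) * grid_sum R (rows1 ++ [:: (X, Some p), (Y, Some q) & rows2]) Bs K s =
  X * grid_sum R (rows1 ++ [:: (Y, Some q), (X, Some p) & rows2]) Bs K s -
  Y * grid_sum R (rows1 ++ [:: (X, Some q), (Y, Some p) & rows2]) Bs K s.
Proof.
move=> pq <-; rewrite !grid_sum_cat /=.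
have gZ a K1 : grid_sum R rows2 Bs (fun l => a * K1 l) s = a * grid_sum R rows2 Bs K1 s.
  rewrite -[RHS]addr0 -(grid_sum0 R rows2 Bs s) -grid_sum_lin.
  by congr grid_sum; apply/funext => l; rewrite addr0.
rewrite -[- (Y * _)]mulNr -[- Y * _]gZ -grid_sum_lin -gZ; congr grid_sum; apply/funext => l.
by rewrite yang_baxter // mulNr.
Qed.

Lemma row_sum_nseq_None X e d Bs s K : (d <= size Bs)%N ->
  row_sum R X e None Bs (nseq d None ++ s) K =
  (\prod_(B <- take d Bs) (X * B - 1)) *
    row_sum R X e None (drop d Bs) s (fun l => K (nseq d None ++ l)).
Proof.
elim: d Bs K => [|d IH] [|B Bs] K //= dB; rewrite ?big_nil ?mul1r //.
by rewrite IH // big_cons mulrA.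
Qed.

End AdjacentRows.

Definition ints (lo : int) (N : nat) : seq int := [seq lo + i%:Z | i <- iota 0 N].
Arguments ints : simpl never.

Lemma size_ints lo N : size (ints lo N) = N.
Proof. by rewrite size_map size_iota. Qed.

Lemma mem_ints lo N j : (j \in ints lo N) = (lo <= j < lo + N%:Z).
Proof.
apply/mapP/idP => [[i]|h]; first by rewrite mem_iota => hi ->; lia.
by exists `|j - lo|%N; rewrite ?mem_iota; lia.
Qed.

Lemma ints_cat lo m k : ints lo (m + k) = ints lo m ++ ints (lo + m%:Z) k.
Proof.
rewrite /ints iotaD map_cat add0n; congr cat.
rewrite -{1}[m]addn0 iotaDl -map_comp; apply: eq_map => i /=; lia.
Qed.

Lemma ints_cons lo N : ints lo N.+1 = lo :: ints (lo + 1) N.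
Proof. by rewrite -add1n ints_cat /ints /= addr0. Qed.

Lemma ints_rcons lo N : ints lo N.+1 = rcons (ints lo N) (lo + N%:Z).
Proof. by rewrite -addn1 ints_cat -cats1 /ints /= addr0. Qed.

Lemma ints_shift lo d N : ints (lo + d) N = [seq i + d | i <- ints lo N].
Proof. by rewrite -map_comp; apply: eq_map => i /=; lia. Qed.

Lemma ints_split (lo : int) N (i : int) : lo <= i < lo + N%:Z ->
  exists m k, [/\ N = (m + k.+1)%N, i = lo + m%:Z &
                 ints lo N = ints lo m ++ i :: ints (i + 1) k].
Proof.
move=> hi; pose m := `|i - lo|%N; have em : lo + m%:Z = i by lia.
have eN : N = (m + (N - m.+1).+1)%N by lia.
by exists m, (N - m.+1)%N; split; rewrite // [in LHS]eN ints_cat ints_cons em.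
Qed.

Definition sq_rows lo N w : seq (series * option int) :=
  [seq (1 - x_ i, Some (w i)) | i <- ints lo N].

Definition sq_cols lo N : seq series := [seq geom (inr j) | j <- ints lo N].

(* The partition function of the square [lo, lo + N - 1]^2, in which the pipe
   leaving row [i] has label [w i]. *)
Definition sq_sum lo N w : series :=
  grid_sum series (sq_rows lo N w) (sq_cols lo N) (no_pipe series)
    [seq Some j | j <- ints lo N].

Lemma size_sq_cols lo N : size (sq_cols lo N) = N.
Proof. by rewrite size_map size_ints. Qed.

Lemma eq_sq_rows lo N w w' : {in ints lo N, w =1 w'} -> sq_rows lo N w = sq_rows lo N w'.
Proof. by move=> ww; apply/eq_in_map => i /ww ->. Qed.

Lemma inv_unique (A : comNzRingType) (a b c : A) : a * b = 1 -> a * c = 1 -> b = c.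
Proof. by move=> ab ac; rewrite -[b]mulr1 -ac mulrCA mulrA ab mul1r. Qed.

Lemma mulrVK1 (A : comNzRingType) (a b c : A) : b * c = 1 -> a * c * b = a.
Proof. by move=> bc; rewrite -mulrA [c * b]mulrC bc mulr1. Qed.

Lemma rename_geom sigma tau v : cancel sigma tau -> cancel tau sigma ->
  rename tau (geom v) = geom (sigma v).
Proof.
move=> st ts; apply: (inv_unique _ (1 - svar (sigma v))); last exact: geomP.
rewrite -(rename_svar v st ts) -{1}(rename1 _ _ st ts) -renameB -(renameM _ _ st ts).
by rewrite geomP (rename1 _ _ st ts).
Qed.

Section Sx.
Variable i : int.

Let tau (v : var) : var := if v is inl k then inl (s_ i k) else v.
Let tauK : involutive tau. Proof. by case=> k //=; rewrite s_K. Qed.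

Lemma sx_grid_sum rows Bs s :
  sx i (grid_sum series rows Bs (no_pipe series) s) =
  grid_sum series [seq (sx i r.1, r.2) | r <- rows] [seq sx i b | b <- Bs] (no_pipe series) s.
Proof.
rewrite (grid_sum_morph _ _ (sx i)).
- congr grid_sum; apply/funext => l; rewrite /no_pipe.
  case: (all _ _); first exact: (rename1 _ _ tauK tauK).
  exact: seriesP.
- exact: renameB.
- exact: (renameM _ _ tauK tauK).
- exact: (rename1 _ _ tauK tauK).
Qed.

Lemma sx_x k : sx i (1 - x_ k) = 1 - x_ (s_ i k).
Proof.
exact: etrans (renameB tau 1 (x_ k)) (congr2 (fun a b => a - b)
  (rename1 _ _ tauK tauK) (rename_svar (inl k) tauK tauK)).
Qed.

Lemma sx_geom j : sx i (geom (inr j)) = geom (inr j).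
Proof. exact: (rename_geom _ _ (inr j) tauK tauK). Qed.

Lemma sxN f : sx i (- f) = - sx i f.
Proof. exact: seriesP. Qed.

End Sx.

(** The Yang-Baxter equation for the rows [i] and [i + 1]: exchanging the exits gives [w \o s_ i],
    and exchanging the parameters as well amounts to [sx i]. The right-hand side is minus the
    numerator of [tpi], whence the signs below. *)
Lemma sq_sum_tpi (lo : int) N w (i : int) : lo <= i -> i + 1 < lo + N%:Z -> w i < w (i + 1) ->
  (x_ i - x_ (i + 1)) * sq_sum lo N w =
  (1 - x_ i) * sx i (sq_sum lo N (w \o s_ i)) - (1 - x_ (i + 1)) * sq_sum lo N (w \o s_ i).
Proof.
move=> loi iN wi.
have [m [k e]] : exists m k, ints lo N = ints lo m ++ [:: i, i + 1 & ints (i + 1 + 1) k].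
  have [|m [[|k] [Nm im e]]] := ints_split lo N i; [lia | lia |].
  by exists m, k; rewrite e ints_cons.
have sq_sumE v : sq_sum lo N v = grid_sum series
    (sq_rows lo m v ++ [:: (1 - x_ i, Some (v i)), (1 - x_ (i + 1), Some (v (i + 1))) &
                           sq_rows (i + 1 + 1) k v])
    (sq_cols lo N) (no_pipe series) [seq Some j | j <- ints lo N].
  by rewrite /sq_sum /sq_rows e map_cat.
have si : s_ i i = i + 1 by rewrite /s_ eqxx.
have si1 : s_ i (i + 1) = i by rewrite /s_; do ![case: eqP]; lia.
have out j : j != i -> j != i + 1 -> s_ i j = j by rewrite /s_ => /negPf-> /negPf->.
have um : uniq (ints lo N) by rewrite map_inj_uniq ?iota_uniq // => a b; lia.
have sout lo' k' : {in ints lo' k', forall j, j != i /\ j != i + 1} ->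
   sq_rows lo' k' (w \o s_ i) = sq_rows lo' k' w /\
   [seq (sx i r.1, r.2) | r <- sq_rows lo' k' w] = sq_rows lo' k' w.
  move=> h; split; first by apply: eq_sq_rows => j /h[? ?]; rewrite /= out.
  rewrite -map_comp; apply/eq_in_map => j /h[? ?] /=.
  by rewrite sx_x out.
have [r1 r1'] : sq_rows lo m (w \o s_ i) = sq_rows lo m w /\
   [seq (sx i r.1, r.2) | r <- sq_rows lo m w] = sq_rows lo m w.
  apply: sout => j jm; move: um; rewrite e cat_uniq => /and3P[_ /hasPn h _].
  by split; apply/eqP => ej; move: jm; rewrite ej; apply/negP/h; rewrite !inE eqxx ?orbT.
have [r2 r2'] : sq_rows (i + 1 + 1) k (w \o s_ i) = sq_rows (i + 1 + 1) k w /\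
   [seq (sx i r.1, r.2) | r <- sq_rows (i + 1 + 1) k w] = sq_rows (i + 1 + 1) k w.
  by apply: sout => j; rewrite mem_ints; lia.
have cE : [seq sx i b | b <- sq_cols lo N] = sq_cols lo N.
  by rewrite -map_comp; apply: eq_map => j /=; exact: sx_geom.
have sxE : sx i (sq_sum lo N (w \o s_ i)) = grid_sum series
    (sq_rows lo m w ++ [:: (1 - x_ (i + 1), Some (w (i + 1))), (1 - x_ i, Some (w i)) &
                           sq_rows (i + 1 + 1) k w])
    (sq_cols lo N) (no_pipe series) [seq Some j | j <- ints lo N].
  rewrite (sq_sumE (w \o s_ i)) sx_grid_sum cE; congr grid_sum.
  rewrite map_cat /= r1 r2 r1' r2' si si1; congr (_ ++ [:: (_, _), (_, _) & _]).
    by rewrite sx_x si.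
  by rewrite sx_x si1.
have subE (A : comNzRingType) (a b : A) : a - b = (1 - b) - (1 - a) by ring.
have E2 := sq_sumE (w \o s_ i); rewrite /= si si1 r1 r2 in E2.
(* The ratio [r] of the row parameters exists because [1 - x_ (i + 1)] is invertible. *)
have rE : (1 - x_ i) * geom (inl (i + 1)) * (1 - x_ (i + 1)) = 1 - x_ i.
  exact: (mulrVK1 _ _ _ _ (geomP (inl (i + 1)))).
have key := grid_sum_yang_baxter series (w i) (w (i + 1)) _ _ _ (sq_rows lo m w)
  (sq_rows (i + 1 + 1) k w) (sq_cols lo N) (no_pipe series) [seq Some j | j <- ints lo N] wi rE.
refine (etrans (congr2 *%R (subE _ _ _) (sq_sumE w)) (etrans key (esym _))).
exact (congr2 (fun a b => (1 - x_ i) * a - (1 - x_ (i + 1)) * b) sxE E2).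
Qed.

Lemma ints1E m : ints 1 m = [seq i%:Z | i <- iota 1 m].
Proof. by rewrite (iotaDl 1 0) -map_comp; apply: eq_map => i /=; lia. Qed.

Section GridEvaluations.
Variable R : comNzRingType.

(** The bottom row is forced: its pipe, the largest and rightmost, turns east in the last column,
    which has no pipe from the south in the rows above. *)
Lemma grid_sum_add_fixed rows X v Bs B u :
  all (fun r => isSome r.2) rows -> all (fun c => c < v) u -> size u = size Bs ->
  grid_sum R (rcons rows (X, Some v)) (rcons Bs B) (no_pipe R)
    (rcons [seq Some c | c <- u] (Some v)) =
  grid_sum R rows Bs (no_pipe R) [seq Some c | c <- u].
Proof.
move=> es uv su; rewrite grid_sum_rcons -[rcons (map _ _) _]cats1.
rewrite row_sum_forced ?size_cat ?size_map ?size_rcons ?su ?addn1 //.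
rewrite cats1 grid_sum_last_None ?size_map //.
by congr grid_sum; apply/funext => l; rewrite /no_pipe all_rcons.
Qed.

(** Every row is forced: row [i] begins with [n - i] empty cells, then its pipe turns east. *)
Lemma grid_sum_w0 n (X B : int -> R) :
  grid_sum R [seq (X i, Some (n%:Z + 1 - i)) | i <- ints 1 n]
    [seq B j | j <- ints 1 n] (no_pipe R) [seq Some j | j <- ints 1 n] =
  \prod_(i <- ints 1 n) \prod_(j <- ints 1 `|n%:Z - i|) (X i * B j - 1).
Proof.
(* When the rows below row [m] are filled, the pipes [n - m + 1, ..., n] are left, each in its own
   column. *)
suff h m : (m <= n)%N ->
  grid_sum R [seq (X i, Some (n%:Z + 1 - i)) | i <- ints 1 m] [seq B j | j <- ints 1 n]
    (no_pipe R) (nseq (n - m) None ++ [seq Some j | j <- ints (n%:Z - m%:Z + 1) m]) =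
  \prod_(i <- ints 1 m) \prod_(j <- ints 1 `|n%:Z - i|) (X i * B j - 1).
  by have := h n (leqnn n); rewrite subnn subrr add0r.
elim: m => [|m IH] mn.
  by rewrite subn0 big_nil /= cats0 /no_pipe all_nseq orbT.
rewrite (ints_rcons 1 m) map_rcons grid_sum_rcons.
rewrite row_sum_nseq_None ?size_map ?size_iota ?leq_subr //.
rewrite (ints_cons _ m) /=.
have -> : n%:Z - m.+1%:Z + 1 = n%:Z + 1 - (1 + m%:Z) by lia.
rewrite (row_sum_forced _ _ _ _ [::]) //=; last first.
- rewrite map_pK //; apply/allP => c; rewrite mem_ints; lia.
- by rewrite size_map size_ints size_drop size_map size_ints; lia.
rewrite -cats1 big_cat big_seq1 /= mulrC.
have -> : `|n%:Z - (1 + m%:Z)%R|%N = (n - m.+1)%N by lia.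
congr (_ * _).
  rewrite -IH; last exact: ltnW.
  congr grid_sum; have -> : (n - m)%N = (n - m.+1).+1 by lia.
  rewrite -cat1s catA -[[:: None]]/(nseq 1 None) -nseqD addn1.
  by congr (_ ++ map _ _); congr ints; lia.
have -> : ints 1 n = ints 1 (n - m.+1) ++ ints (1 + (n - m.+1)%:Z) m.+1.
  by rewrite -ints_cat subnK.
by rewrite map_cat take_size_cat ?size_map ?size_iota // big_map.
Qed.

Lemma signed_prod (I : Type) (s : seq I) (F : I -> R) :
  (-1) ^+ size s * \prod_(j <- s) (- F j) = \prod_(j <- s) F j.
Proof.
elim: s => [|j s IH]; first by rewrite !big_nil mulr1.
by rewrite !big_cons -IH /= exprS; ring.
Qed.

Lemma w0_prod n (F : int -> int -> R) :
  (-1) ^+ len (w0 n) * \prod_(i <- ints 1 n) \prod_(j <- ints 1 `|n%:Z - i|) (- F i j) =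
  \prod_(1 <= i < n) \prod_(1 <= j < n | (i + j <= n)%N) F i%:Z j%:Z.
Proof.
have -> : len (w0 n) = (\sum_(i <- iota 1 n) (n - i))%N.
  rewrite (len_invs n _ (w0_in_S n)) size_filter count_flatten sumnE !big_map.
  rewrite big_seq [RHS]big_seq; apply: eq_bigr => a; rewrite mem_iota => ha.
  rewrite count_map.
  have -> : iota 1 n = iota 1 a ++ iota (1 + a) (n - a) by rewrite -iotaD subnKC //; lia.
  rewrite count_cat [X in (X + _)%N](_ : _ = 0%N); last first.
    apply/eqP; rewrite -leqn0 leqNgt -has_count; apply/hasPn => b; rewrite mem_iota.
    by rewrite /=; lia.
  rewrite add0n -[RHS](size_iota (1 + a)); apply/eqP; rewrite -all_count.
  by apply/allP => b; rewrite mem_iota /= /w0; do ![case: ifP]; lia.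
rewrite expr_sum ints1E big_map -big_split /=.
transitivity (\prod_(i <- iota 1 n) \prod_(j <- iota 1 (n - i)) F i%:Z j%:Z).
  rewrite big_seq [RHS]big_seq; apply: eq_bigr => i; rewrite mem_iota => hi.
  have -> : `|n%:Z - i%:Z|%N = (n - i)%N by lia.
  by rewrite ints1E big_map -[X in _ ^+ X](size_iota 1) signed_prod.
(* The row [i = n] has an empty product; splitting it off matches the range [i < n] of the
   definition. *)
case: n => [|n]; first by rewrite /index_iota /= !big_nil.
have -> : iota 1 n.+1 = iota 1 n ++ [:: n.+1] by rewrite -(addn1 n) iotaD add1n addn1.
rewrite big_cat big_seq1 /= subnn big_nil mulr1.
rewrite /index_iota subn1 /= big_seq [RHS]big_seq; apply: eq_bigr => i; rewrite mem_iota => hi.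
rewrite -[RHS]big_filter; congr bigop.
have -> : iota 1 n = iota 1 (n.+1 - i) ++ iota (1 + (n.+1 - i)) i.-1.
  by rewrite -iotaD; congr iota; lia.
rewrite filter_cat (_ : filter _ (iota (1 + _) _) = [::]); last first.
  by rewrite -(filter_pred0 (iota (1 + (n.+1 - i)) i.-1)); apply/eq_in_filter => j;
    rewrite mem_iota /=; lia.
rewrite cats0; apply/esym/all_filterP/allP => j; rewrite mem_iota; lia.
Qed.

End GridEvaluations.

Lemma tpi_sign i (b : bool) (f z : series) :
  (x_ i - x_ (i + 1)) * z = (1 - x_ i) * sx i f - (1 - x_ (i + 1)) * f ->
  tpi i ((-1) ^+ b * f) = (-1) ^+ (~~ b) * z.
Proof.
have sg (A : comNzRingType) (c : bool) (a : A) : (-1) ^+ c * a = if c then - a else a.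
  by case: c; rewrite ?mulN1r ?mul1r.
have xreg r : (x_ i - x_ (i + 1)) * r = 0 -> r = 0.
  by apply: svarB_reg; apply/eqP => -[] /eqP; lia.
have e1 (A : comNzRingType) (d p q t u v : A) :
  d * v = p * t - q * u -> d * - v = q * u - p * t by move=> e; rewrite mulrN e opprB.
have e2 (A : comNzRingType) (d p q t u v : A) :
  d * v = p * t - q * u -> d * v = q * - u - p * - t by move=> ->; ring.
move=> E; refine (etrans (congr1 (tpi i) (sg _ b f)) (etrans _ (esym (sg _ (~~ b) z)))).
case: b; apply: sdiv_eq => //; last exact: e1 E.
exact: etrans (e2 _ _ _ _ _ _ _ E) (congr1 (fun t => (1 - x_ (i + 1)) * - f - (1 - x_ i) * t)
  (esym (sxN i f))).
Qed.

Lemma sq_sum_stable n k w : in_S n w -> sq_sum 1 (n + k) w = sq_sum 1 n w.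
Proof.
move=> wS; elim: k => [|k IH]; first by rewrite addn0.
rewrite -IH addnS /sq_sum /sq_rows /sq_cols ints_rcons !map_rcons wS.2; last by lia.
apply: grid_sum_add_fixed; last by rewrite !size_map.
  by apply/allP => r /mapP[i _ ->].
by apply/allP => c; rewrite mem_ints; lia.
Qed.

Lemma is_groth_in_S n w g : is_groth n w g -> in_S n w.
Proof.
elim=> {w g} [w ww|w i g hi _ _ wS].
  by rewrite (funext ww); apply: w0_in_S.
have -> : w = (w \o s_ i%:Z) \o s_ i%:Z by apply/funext => k /=; rewrite s_K.
by apply: in_S_s => //; lia.
Qed.

Lemma is_groth_sq_sum n w g : is_groth n w g -> g = (-1) ^+ len w * sq_sum 1 n w.
Proof.
elim=> {w g} [w /funext ->|w i g hi lw gw IH].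
  apply/esym; apply: etrans (w0_prod _ n (fun i j => ominus (x_ i) (a_ j))).
  congr (_ * _).
  have -> : sq_sum 1 n (w0 n) =
      \prod_(i <- ints 1 n) \prod_(j <- ints 1 `|n%:Z - i|) ((1 - x_ i) * geom (inr j) - 1).
    rewrite -(grid_sum_w0 _ n (fun i => 1 - x_ i) (fun j => geom (inr j))).
    congr grid_sum; apply/eq_in_map => i; rewrite mem_ints => hi.
    by congr (_, Some _); rewrite /w0; case: ifP; lia.
  apply: eq_bigr => i _; apply: eq_bigr => j _.
  exact: esym (ominusN _ _).
have wS : in_S n w.
  by apply: is_groth_in_S; apply: groth_tpi gw.
have hi' : 1 <= i%:Z < n%:Z by lia.
rewrite IH -signr_odd (sign_len_s n) // -[in RHS]signr_odd -[in RHS](negbK (odd (len w))).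
apply: tpi_sign; apply: sq_sum_tpi; [lia | lia |].
by rewrite -(ascent_len n).
Qed.

(** Lengths in [S_n] are bounded by [n * n], so climbing along ascents ends, and a permutation in
    [S_n] without ascents is [w0 n]. *)
Lemma is_groth_ex n w : in_S n w -> exists g, is_groth n w g.
Proof.
move: {2}(n * n - len w)%N (leqnn (n * n - len w)%N) => d.
elim: d w => [|d IH] w dw wS.
all: have [[i hi wi]|no] := pselect (exists2 i, 1 <= i < n%:Z & w i < w (i + 1)); last first.
1,3: exists (\prod_(1 <= i < n) \prod_(1 <= j < n | (i + j <= n)%N)
       ominus (x_ i%:Z) (a_ j%:Z)); apply: groth_w0; apply: in_S_decr => // i hi;
  rewrite lt_neqAle leNgt (inj_eq (bij_inj wS.1)); apply/andP; split;
    [lia | by apply/negP => wi; apply: no; exists i].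
all: have wsS := in_S_s _ _ _ wS hi.
all: have lw := len_s _ _ _ wS hi; rewrite wi in lw.
all: have : (len (w \o s_ i) <= n * n)%N by
  rewrite (len_invs n _ wsS) size_filter (leq_trans (count_size _ _)) // size_allpairs !size_iota.
  lia.
move=> lws; have [|g gws] := IH (w \o s_ i) _ wsS; first by lia.
have ei : i = (`|i|%N)%:Z by lia.
rewrite ei in gws lw; exists (tpi `|i|%N%:Z g); apply: groth_tpi gws; first by lia.
by rewrite lw.
Qed.

(** The partition function involves no chain of ascents and is stable in [n], so all candidates for
    [groth w] coincide. *)
Lemma groth_sq_sum n w : in_S n w -> groth w = (-1) ^+ len w * sq_sum 1 n w.
Proof.
move=> wS; rewrite /groth; have [g gw] := is_groth_ex _ _ wS.
apply: xget_unique; first by exists n; rewrite -(is_groth_sq_sum _ _ _ gw).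
move=> g' [n' gw']; have wS' := is_groth_in_S _ _ _ gw'.
rewrite (is_groth_sq_sum _ _ _ gw'); congr (_ * _).
have [/subnKC <-|/ltnW/subnKC <-] := leqP n n'.
  exact: sq_sum_stable.
by apply/esym; apply: sq_sum_stable.
Qed.

(** * The limit *)

Section Shift.
Variable d : int.

Let sigma (v : var) : var := match v with inl i => inl (i + d) | inr i => inr (i + d) end.
Let tau (v : var) : var := match v with inl i => inl (i - d) | inr i => inr (i - d) end.
Let st : cancel sigma tau. Proof. by case=> i /=; rewrite addrK. Qed.
Let ts : cancel tau sigma. Proof. by case=> i /=; rewrite subrK. Qed.

(** Renaming the variables moves the square; the labels may be moved along because a translation
    preserves their order. *)
Lemma shift_sq_sum lo N w : shift d (sq_sum lo N w) = sq_sum (lo + d) N (gamma d w).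
Proof.
rewrite /sq_sum (grid_sum_morph _ _ (shift d)); first last.
- exact: (rename1 _ _ st ts).
- exact: (renameM _ _ st ts).
- exact: renameB.
have fmono : {mono (fun k : int => k + d) : x y / x <= y} by move=> x y; rewrite lerD2r.
rewrite /sq_rows /sq_cols !ints_shift -!map_comp.
have -> : (fun l => shift d (no_pipe series l)) =
    (fun l => no_pipe series [seq omap (fun k : int => k + d) a | a <- l]).
  apply/funext => l; rewrite /no_pipe all_map.
  have -> : all (preim (omap (fun k : int => k + d)) (pred1 None)) l = all (pred1 None) l.
    by apply: eq_all => -[a|].
  case: (all _ _); first exact: (rename1 _ _ st ts).
  exact: seriesP.
have sx1 k : shift d (1 - x_ k) = 1 - x_ (k + d).
  exact: etrans (renameB tau 1 (x_ k)) (congr2 (fun a b => a - b)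
    (rename1 _ _ st ts) (rename_svar (inl k) st ts)).
have sgeom k : shift d (geom (inr k)) = geom (inr (k + d)).
  exact: (rename_geom _ _ (inr k) st ts).
rewrite -(grid_sum_relabel _ _ fmono) -!map_comp; congr grid_sum.
- by apply: eq_map => k /=; rewrite sx1 /gamma addrK.
- by apply: eq_map => k /=; rewrite sgeom.
Qed.

Lemma shift_sign k f : shift d ((-1) ^+ k * f) = (-1) ^+ k * shift d f.
Proof.
have sg (A : comNzRingType) (a : A) : (-1) ^+ k * a = if odd k then - a else a.
  by rewrite -signr_odd; case: odd; rewrite ?mulN1r ?mul1r.
refine (etrans (congr1 (shift d) (sg _ f)) (etrans _ (esym (sg _ (shift d f))))).
by case: odd => //; apply: seriesP.
Qed.

End Shift.

Lemma grid_sum_first_mod (R : comNzRingType) rows X k B Bs s : size s = size Bs ->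
  exists c, grid_sum R ((X, Some k) :: rows) (B :: Bs) (no_pipe R) (Some k :: s) =
    grid_sum R rows Bs (no_pipe R) s + (X * B - 1) * c.
Proof.
move=> ss /=; apply: (grid_sum_mod_first R (X * B - 1) k) => // l /=; first by eexists.
move=> sl; exists 0; rewrite mulr0 addr0 -[RHS](row_sum_no_pipe R k X Bs l) ?sl //.
rewrite -[RHS]addr0; congr (_ + _); exact: row_sum0.
Qed.

Definition idx (v : var) : int := match v with inl i => i | inr i => i end.

(** The two sums differ by a multiple of the corner weight [(a - x) / (1 - a)], all of whose
    monomials contain [x_ lo] or [a_ lo]. *)
Lemma coef_sq_sum_first (lo : int) N w (m : {mset var}%mset) :
  w lo = lo -> (forall v, v \in m -> idx v != lo) ->
  coef (sq_sum lo N.+1 w) m = coef (sq_sum (lo + 1) N w) m.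
Proof.
move=> wlo mlo; have [|c] := grid_sum_first_mod series (sq_rows (lo + 1) N w) (1 - x_ lo) lo
  (geom (inr lo)) (sq_cols (lo + 1) N) [seq Some j | j <- ints (lo + 1) N].
  by rewrite !size_map.
have -> : grid_sum series ((1 - x_ lo, Some lo) :: sq_rows (lo + 1) N w)
   (geom (inr lo) :: sq_cols (lo + 1) N) (no_pipe series)
   (Some lo :: [seq Some j | j <- ints (lo + 1) N]) = sq_sum lo N.+1 w.
  by rewrite /sq_sum /sq_rows /sq_cols ints_cons /= wlo.
have geps (A : comNzRingType) (x a g e t : A) :
    - ((x - a) * g) = e -> e * t = a * (g * t) - x * (g * t) by move=> <-; ring.
have := geps _ _ _ _ _ c (etrans (esym (congr1 -%R (ominusE (x_ lo) (inr lo))))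
  (ominusN (x_ lo) (inr lo))).
have svar0 v f : v \notin m -> coef (svar v * f) m = 0.
  by move=> vm; apply: etrans (coef_svarM v f m) _; rewrite (negPf vm).
move=> e1 e2; rewrite e2 {e2} scoefD -[RHS]addr0; congr (_ + _).
refine (etrans (congr1 (fun f => coef f m) e1) _).
rewrite scoefB; refine (etrans (congr2 (fun a b => a - b) (svar0 _ _ _) (svar0 _ _ _)) (subrr 0)).
all: by apply/negP => /mlo; rewrite eqxx.
Qed.

(** A common setting for the given permutation, with [m = 0], and for [w_part lam], with [m = n]. *)
Definition in_box (m n : nat) (w : int -> int) : Prop :=
  bijective w /\ forall i, ~~ (1 - m%:Z <= i <= n%:Z) -> w i = i.

Lemma in_box_in_S n w : in_S n w -> in_box 0 n w.
Proof. by rewrite /in_box subr0. Qed.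

Lemma in_box_gamma m n w (p : int) : in_box m n w -> p <= 1 - m%:Z -> p <= n%:Z + 1 ->
  in_S `|(n%:Z + 1)%R - p|%N (gamma (1 - p) w).
Proof.
move=> [[v vw wv] wid] pm pn; split.
  by exists (gamma (1 - p) v) => k; rewrite /gamma addrK ?vw ?wv subrK.
by move=> i hi; rewrite /gamma wid ?subrK //; lia.
Qed.

Lemma bs_groth_cvg m n w : in_box m n w ->
  cvg_minfty (fun p => sq_sum p `|(n%:Z + 1)%R - p|%N w) ((-1) ^+ len w * bs_groth w).
Proof.
move=> wB; set u := (fun p => _).
have [L uL] : exists L, cvg_minfty u L.
  (* For [p <= p0 k], the added index [p - 1] lies below the indices of all variables in [k]; the
     bound [1 - m] makes it a fixed point of [w]. *)
  pose p0 (k : monom) := foldr Num.min (1 - m%:Z) [seq idx v | v <- enum_mset k].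
  have p0m k : p0 k <= 1 - m%:Z.
    by rewrite /p0; elim: (map _ _) => [|i s IH] //=; rewrite ge_min IH orbT.
  have p0v (k : {mset var}%mset) v : v \in k -> p0 k <= idx v.
    have -> : (v \in k) = (v \in enum_mset k) by [].
    rewrite /p0; elim: (enum_mset k) => [|z s IH] //=; rewrite in_cons ge_min.
    by case/orP => [/eqP ->|/IH ->]; rewrite ?lexx ?orbT.
  apply: (cvg_minfty_stable _ p0) => k p pk; have pm := p0m k; rewrite /u.
  have -> : `|(n%:Z + 1)%R - (p - 1)%R|%N = `|(n%:Z + 1)%R - p|%N.+1 by lia.
  rewrite coef_sq_sum_first ?subrK //; first by apply: wB.2; lia.
  by move=> v /p0v h; apply/eqP; lia.
have bsE : bs_groth w = (-1) ^+ len w * L.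
  apply: lim_minftyE; apply: (cvg_minfty_eq (fun p => (-1) ^+ len w * u p) _ _ (- m%:Z - n%:Z)).
    move=> p hp; have gS : in_S `|(n%:Z + 1)%R - p|%N (gamma (1 - p) w).
      by apply: (in_box_gamma m) => //; lia.
    rewrite (groth_sq_sum _ _ gS) len_gamma shift_sign shift_sq_sum /u.
    have -> : 1 + (p - 1) = p by lia.
    by have := gammaK (1 - p) w; rewrite opprB => ->.
  exact: cvg_minftyM.
have sgK (A : comNzRingType) (k : nat) (a : A) : (-1) ^+ k * ((-1) ^+ k * a) = a.
  by rewrite mulrA -exprD addnn -mul2n exprM sqrrN !expr1n mul1r.
by rewrite bsE (sgK _ (len w) L).
Qed.

(** * Pipes with nonpositive labels *)

(** A nonpositive [p] stands east of some [q], as it does after crossing a larger label. Equality is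
    allowed so that distinctness of labels need not be carried along. *)
Definition bad (l : seq (option int)) : Prop :=
  exists p q : int, [/\ p <= 0, p <= q & subseq [:: q; p] (pmap id l)].

Lemma subseq2_cons (p q c : int) r :
  subseq [:: q; p] (c :: r) = if q == c then p \in r else subseq [:: q; p] r.
Proof. by rewrite /=; case: eqP => _ //; rewrite sub1seq. Qed.

Lemma subseq2_cat (p q e : int) r : subseq [:: q; p] (r ++ [:: e]) -> e != p ->
  subseq [:: q; p] r.
Proof.
elim: r => [|c r IH]; first by rewrite cat0s subseq2_cons; case: eqP.
rewrite cat_cons !subseq2_cons; case: eqP => [_|_]; last exact: IH.
by rewrite mem_cat inE eq_sym => /orP[|/eqP->]; rewrite ?eqxx.
Qed.

Lemma subseq2_cut_move (p q : int) u a b v : p <= q ->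
  subseq [:: q; p] (u ++ a :: b :: v) ->
  subseq [:: q; p] (u ++ Num.max a b :: Num.min a b :: v).
Proof.
move=> pq; elim: u => [|c u IH]; last first.
  by rewrite !cat_cons !subseq2_cons mem_cut_move; case: ifP.
rewrite !cat0s; have [ab|ab|<-] := ltgtP a b => //; rewrite !subseq2_cons !inE.
have [qa|qa] := eqVneq q a; first by rewrite qa (lt_eqF ab) (_ : (p == b) = false) //; lia.
by case: eqP => // _ ->; rewrite orbT.
Qed.

Lemma bad_cat u l : bad l -> bad (u ++ l).
Proof.
move=> [p [q [p0 pq s]]]; exists p, q; split=> //.
by rewrite pmap_cat; apply: subseq_trans s (suffix_subseq _ _).
Qed.

Section Vanishing.
Variable R : comNzRingType.
Implicit Types (X Y B : R) (h e : option int) (Bs : seq R) (s l : seq (option int)).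
Implicit Types K : seq (option int) -> R.
Notation row_sum := (row_sum R).
Notation grid_sum := (grid_sum R).

Definition vanishes (N : nat) K := forall l, size l = N -> bad l -> K l = 0.

(** Crossings keep [q] west of [p], and a positive exit cannot take [p] out. *)
Lemma vanishes_row N (e : int) X Bs K : 0 < e -> size Bs = N -> vanishes N K ->
  vanishes N (fun l => row_sum X (Some e) None Bs l K).
Proof.
move=> e0 sB KN l sl [p [q [p0 pq s]]].
apply: (row_sum_cut0 R (fun u => subseq [:: q; p] u)); rewrite ?sl //.
- by move=> u a b v; apply: subseq2_cut_move.
- move=> l' sl' /subseq2_cat h; apply: KN => //.
  by exists p, q; split=> //; apply: h; lia.
Qed.

Definition pos_exit (r : R * option int) : bool := if r.2 is Some e then 0 < e else false.

Lemma vanishes_grid N rows Bs K : all pos_exit rows -> size Bs = N -> vanishes N K ->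
  vanishes N (grid_sum rows Bs K).
Proof.
elim: rows K => [|[X [e|]] rows IH] K //= /andP[e0 es] sB KN.
by apply: IH => //; apply: vanishes_row.
Qed.

Lemma vanishes_cons N k K : vanishes N.+1 K -> vanishes N (fun l => K (k :: l)).
Proof. by move=> KN l sl lb; apply: KN; rewrite /= ?sl //; apply: (bad_cat [:: k]). Qed.

Lemma vanishes_cat N t K : vanishes (size t + N) K -> vanishes N (fun l => K (t ++ l)).
Proof. by move=> KN l sl lb; apply: KN; rewrite ?size_cat ?sl //; apply: bad_cat. Qed.

(** The label [k] has moved on to the east while [k2] left to the north. The exit being positive,
    [k] must also leave north, and then it stands east of [k2]. *)
Lemma row_sum_crossed0 (e k k2 : int) X Bs s K : 0 < e -> k <= 0 -> k <= k2 ->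
  size s = size Bs -> vanishes (size s).+1 K ->
  row_sum X (Some e) (Some k) Bs s (fun l => K (Some k2 :: l)) = 0.
Proof.
move=> e0 k0 kk ss KN; apply: (row_sum_mem0 R k) => //=; first by rewrite mem_head.
move=> l sl; rewrite mem_cat inE => /orP[kl|/eqP]; last by lia.
apply: KN; rewrite /= ?sl //; exists k, k2; split=> //=.
by rewrite eqxx sub1seq.
Qed.

(** A pipe of [u] turning east would at once cross its right neighbour, whose label is larger. Only
    the last pipe [a] may turn. *)
Lemma row_sum_intact (e a : int) X Bs u s K : 0 < e ->
  all (fun k => k <= 0) u -> sorted <%R (rcons u a) ->
  size ([seq Some k | k <- rcons u a] ++ s) = size Bs -> vanishes (size Bs) K ->
  row_sum X (Some e) None Bs ([seq Some k | k <- rcons u a] ++ s) K =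
  row_sum X (Some e) None (drop (size u) Bs) (Some a :: s) (fun l => K ([seq Some k | k <- u] ++ l)).
Proof.
move=> e0; elim: u Bs K => [|k u IH] Bs K; first by rewrite drop0.
case: Bs => [|B Bs] //= /andP[k0 u0] srt [ss] KN.
rewrite IH //; [|exact: path_sorted srt|exact: vanishes_cons].
rewrite -[RHS]add0r; congr (_ + _); move: srt ss KN.
case E : (rcons u a) => [|k2 v] /=; first by case: (u) E.
case: Bs => [|B2 Bs] //= /andP[kk _] [ss] KN; rewrite (min_l (ltW kk)) (max_r (ltW kk)).
apply: (row_sum_crossed0 e k k2 X Bs _ (fun l => K (None :: l))) => //; first exact: ltW.
by rewrite ss; apply: vanishes_cons.
Qed.

(** Each row sets at most one more nonpositive pipe free, the rightmost one still in place. As [u1]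
    has at least as many pipes as there are rows, those of [ud] stay vertical throughout. *)
Lemma grid_sum_strip rows (Bd B2 : seq R) K (ud u1 : seq int) s :
  all pos_exit rows -> all (fun k => k <= 0) (ud ++ u1) -> sorted <%R (ud ++ u1) ->
  size ud = size Bd -> (size u1 + size s)%N = size B2 -> (size rows <= size u1)%N ->
  vanishes (size Bd + size B2) K ->
  grid_sum rows (Bd ++ B2) K ([seq Some k | k <- ud] ++ [seq Some k | k <- u1] ++ s) =
  grid_sum rows B2 (fun l => K ([seq Some k | k <- ud] ++ l)) ([seq Some k | k <- u1] ++ s).
Proof.
move=> + + + sd + + KN; elim/last_ind: rows u1 s => [|rows [X [e|]] IH] u1 s.
- by [].
- rewrite all_rcons => /andP[e0 es]; case/lastP: u1 => [|u1 a]; first by rewrite size_rcons.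
  rewrite -rcons_cat all_rcons !size_rcons ltnS => /andP[a0 u0] srt s2 szr.
  rewrite !grid_sum_rcons catA -map_cat -rcons_cat row_sum_intact //; first last.
  + by apply: vanishes_grid => //; rewrite size_cat.
  + by rewrite !(size_cat, size_map, size_rcons) sd -s2 !addSn addnS addnA.
  rewrite row_sum_intact //; first last.
  + by apply: vanishes_grid => //; apply: vanishes_cat; rewrite size_map sd.
  + by rewrite size_cat size_map size_rcons.
  + by move: srt; rewrite rcons_cat => /cat_sorted2[].
  + by move: u0; rewrite all_cat => /andP[].
  rewrite size_cat drop_cat sd ltnNge leq_addr /= addKn; apply: eq_row_sum.
    by rewrite /= size_drop -s2; lia.
  move=> l /= sl; rewrite map_cat -catA IH //; last by rewrite sl; lia.
  by move: srt; rewrite -cats1 => /cat_sorted2[].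
- by rewrite all_rcons.
Qed.

Lemma grid_sum_notin (q : int) rows Bs l : q \in pmap id l ->
  all (fun r => r.2 != Some q) rows -> size l = size Bs ->
  grid_sum rows Bs (no_pipe R) l = 0.
Proof.
elim/last_ind: rows l => [|rows [X e] IH] l ql es sl.
  rewrite /= /no_pipe; case: allP => // h; move: ql; rewrite mem_pmap map_id => /h.
  by [].
rewrite grid_sum_rcons; move: es; rewrite all_rcons => /andP[/= eq es].
apply: (row_sum_mem0 R q) => // l' sl'; rewrite mem_cat => /orP[ql'|].
  by apply: IH; rewrite ?sl'.
by case: e eq => [e|] //=; rewrite inE => /eqP h /eqP e'; rewrite e' in h.
Qed.

(** The pair [q], [p] survives each row whose exit is not [p]. After row [p] the label [q] is still
    on the cut, but all exits above are smaller than [p]. *)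
Lemma vanishes_top lo m (X : int -> R) Bs :
  vanishes (size Bs) (grid_sum [seq (X i, Some i) | i <- ints lo m] Bs (no_pipe R)).
Proof.
move=> l sl [p [q [_ pq]]]; elim: m l sl => [|m IH] l sl s.
  apply: (grid_sum_notin p) => //; apply: (mem_subseq s); by rewrite !inE eqxx orbT.
rewrite ints_rcons map_rcons grid_sum_rcons.
apply: (row_sum_cut0 R (fun u => subseq [:: q; p] u)); rewrite ?sl //.
  by move=> u a b v; apply: subseq2_cut_move.
move=> l' sl' /= h; have [ep|ep] := eqVneq (lo + m%:Z) p; last first.
  by apply: IH => //; apply: subseq2_cat h ep.
apply: (grid_sum_notin q); rewrite ?sl' //.
  move: h; elim: (pmap id l') => [|c r IHr]; first by rewrite cat0s subseq2_cons; case: eqP.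
  rewrite cat_cons subseq2_cons inE; case: eqP => //= _; exact: IHr.
apply/allP => r /mapP[i]; rewrite mem_ints => hi -> /=.
by apply/eqP => -[]; lia.
Qed.

(** * Expansion of the partition functions into tilings *)

Definition twt X B (t : tile) : R :=
  match t with Defs.Empty => X * B - 1 | ElbowNW => X * B | _ => 1 end.

Definition rwt X Bs (ts : seq tile) : R := \prod_(tb <- zip ts Bs) twt X tb.2 tb.1.

Fixpoint gwt (Xs : seq R) Bs (g : seq (seq tile)) : R :=
  match Xs, g with
  | X :: Xs', ts :: g' => rwt X Bs ts * gwt Xs' Bs g'
  | _, _ => 1
  end.

End Vanishing.

Definition tcut (t : tile) (W S : option int) : option (option int * option int) :=
  match t, W, S with
  | Defs.Empty, None, None => Some (None, None)
  | ElbowNW, Some p, None => Some (None, Some p)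
  | ElbowSE, None, Some q => Some (Some q, None)
  | Horiz, Some p, None => Some (Some p, None)
  | Vert, None, Some q => Some (None, Some q)
  | Cross, Some p, Some q => Some (Some (Num.min p q), Some (Num.max p q))
  | _, _, _ => None
  end.

Definition positive (W : option int) : bool := if W is Some p then 0 < p else true.

(** The value of [positive] at [None] does not admit anything new, since [tcut] rejects a crossing
    with a missing label. *)
Definition tstep (t : tile) (W S : option int) : option (option int * option int) :=
  if t is Cross then if positive W && positive S then tcut Cross W S else None
  else tcut t W S.

Fixpoint prow (ts : seq tile) (h : option int) (s : seq (option int)) :
    option (option int * seq (option int)) :=
  match ts, s with
  | [::], [::] => Some (h, [::])
  | t :: ts', T :: s' =>
      if tstep t h T is Some (E, N) then
        if prow ts' E s' is Some (e, l) then Some (e, N :: l) else None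
      else None
  | _, _ => None
  end.

Fixpoint pgrid (g : seq (seq tile)) (s : seq (option int)) :
    option (seq (option int) * seq (option int)) :=
  if g is ts :: g' then
    if pgrid g' s is Some (es, l) then
      if prow ts None l is Some (e, l') then Some (e :: es, l') else None
    else None
  else Some ([::], s).

Definition tiles := [:: Defs.Empty; ElbowNW; ElbowSE; Horiz; Vert; Cross].

Fixpoint words (m : nat) : seq (seq tile) :=
  if m is m'.+1 then [seq t :: l | t <- tiles, l <- words m'] else [:: [::]].

Lemma wordsS m : words m.+1 = [seq t :: l | t <- tiles, l <- words m].
Proof. by []. Qed.

Fixpoint grids (n m : nat) : seq (seq (seq tile)) :=
  if n is n'.+1 then [seq r :: g | r <- words m, g <- grids n' m] else [:: [::]].

Lemma size_prow ts h s e l : prow ts h s = Some (e, l) -> size l = size s.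
Proof.
elim: ts h s e l => [|t ts IH] h [|T s] e l //=; first by case=> _ <-.
case: (tstep t h T) => [[E N]|] //; case r : (prow ts E s) => [[e' l']|] // [_ <-] /=.
by rewrite (IH _ _ _ _ r).
Qed.

Lemma size_pgrid g s es l : pgrid g s = Some (es, l) -> size l = size s.
Proof.
elim: g es l => [|ts g IH] es l /=; first by case=> _ <-.
case r : (pgrid g s) => [[es' l']|] //; case r' : (prow ts None l') => [[e l2]|] // [_ <-].
by rewrite (size_prow _ _ _ _ _ r') (IH _ _ r).
Qed.

Section TileSums.
Variable R : comNzRingType.
Implicit Types (X Y B : R) (Bs : seq R) (s l : seq (option int)).
Implicit Types K : seq (option int) -> R.

(** Each branch of [cell] is one tile. Crossings with a nonpositive label are absent from the
    right-hand side; in [row_sum] they contribute 0 because [K] vanishes on bad lists. *)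
Lemma row_sum_tiles (e : int) X Bs h s K : 0 < e -> size s = size Bs ->
  vanishes R (size s) K ->
  row_sum R X (Some e) h Bs s K = \sum_(ts <- words (size s))
    if prow ts h s is Some (e', l) then
      if e' == Some e then rwt R X Bs ts * K l else 0 else 0.
Proof.
move=> e0; elim: Bs h s K => [|B Bs IH] h [|T s] K //.
  by move=> _ _; rewrite [words _]/= big_seq1 /rwt /= big_nil mul1r.
move=> [ss] KN; rewrite [size (T :: s)]/= wordsS big_allpairs_dep.
pose S t := \sum_(ts <- words (size s)) if prow (t :: ts) h (T :: s) is Some (e', l) then
      if e' == Some e then rwt R X (B :: Bs) (t :: ts) * K l else 0 else 0.
have S0 t : tstep t h T = None -> S t = 0.
  by move=> e1; apply: big1 => ts _ /=; rewrite e1.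
have S1 t E N : tstep t h T = Some (E, N) ->
    S t = twt R X B t * row_sum R X (Some e) E Bs s (fun l => K (N :: l)).
  move=> e1; rewrite IH //; last exact: vanishes_cons.
  rewrite mulr_sumr; apply: eq_bigr => ts _ /=; rewrite e1.
  case: (prow ts E s) => [[e' l]|]; rewrite ?mulr0 //.
  by case: ifP; rewrite ?mulr0 // /rwt big_cons mulrA.
rewrite -[RHS]/(\sum_(t <- tiles) S t) /tiles !big_cons big_nil {IH}.
clearbody S; case: h T KN S0 S1 => [p|] [q|] KN S0 S1 /=.
- rewrite (S0 Defs.Empty) // (S0 ElbowNW) // (S0 ElbowSE) // (S0 Horiz) // (S0 Vert) // !add0r addr0.
  case: (boolP (0 < Num.min p q)) => pq.
    rewrite (S1 Cross (Some (Num.min p q)) (Some (Num.max p q))) ?mul1r //.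
    by move: pq; rewrite lt_min /tstep /= => ->.
  rewrite S0; last by rewrite /tstep /= -lt_min (negPf pq).
  apply: row_sum_crossed0 => //; first by rewrite leNgt.
  by rewrite ge_min !le_max !lexx orbT.
- rewrite (S0 Cross); last by rewrite /tstep /= if_same.
  rewrite (S0 Defs.Empty) // (S0 ElbowSE) // (S0 Vert) //.
  rewrite (S1 ElbowNW None (Some p)) // (S1 Horiz (Some p) None) //= mul1r; ring.
- rewrite (S0 Cross); last by rewrite /tstep /= if_same.
  rewrite (S0 Defs.Empty) // (S0 ElbowNW) // (S0 Horiz) //.
  rewrite (S1 ElbowSE (Some q) None) // (S1 Vert None (Some q)) //= !mul1r; ring.
- rewrite (S0 Vert) // (S0 Cross) // (S0 ElbowNW) // (S0 Horiz) // (S0 ElbowSE) //.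
  by rewrite (S1 Defs.Empty None None) //= !addr0.
Qed.

Lemma grid_sum_tiles (rows : seq (R * option int)) Bs s K :
  all (pos_exit R) rows -> size s = size Bs -> vanishes R (size s) K ->
  grid_sum R rows Bs K s = \sum_(g <- grids (size rows) (size s))
    if pgrid g s is Some (es, l) then
      if es == [seq r.2 | r <- rows] then gwt R [seq r.1 | r <- rows] Bs g * K l else 0 else 0.
Proof.
elim: rows K => [|[X [e|]] rows IH] K //=; first by rewrite big_seq1 /= mul1r.
move=> /andP[e0 es] ss KN; rewrite IH //; last by apply: vanishes_row; rewrite // ss.
rewrite big_allpairs_dep exchange_big /=; apply: eq_bigr => g _.
case r : (pgrid g s) => [[es' l]|]; last by rewrite big1.
have sl := size_pgrid _ _ _ _ r.
have [->|ne] := eqVneq es' _; last first.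
  rewrite big1 // => ts _; case: (prow ts None l) => [[e' l']|] //.
  by rewrite eqseq_cons (negPf ne) andbF.
rewrite row_sum_tiles ?sl // mulr_sumr; apply: eq_bigr => ts _.
case: (prow ts None l) => [[e' l']|]; rewrite ?mulr0 //.
rewrite eqseq_cons eqxx andbT; case: ifP => _; rewrite ?mulr0 //.
by rewrite mulrA [gwt _ _ _ _ * _]mulrC.
Qed.

End TileSums.

(** * Rectangular pipedreams *)

Lemma mkseq_cons T (f : nat -> T) m : mkseq f m.+1 = f 0%N :: mkseq (fun i => f i.+1) m.
Proof. by rewrite /mkseq /= (iotaDl 1 0) -map_comp. Qed.

Lemma mem_words m ts : (ts \in words m) = (size ts == m).
Proof.
have mt t : t \in tiles by case: t; rewrite !inE eqxx ?orbT.
elim: m ts => [|m IH] ts; first by rewrite inE size_eq0.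
apply/allpairsP/eqP => [[[t l] /= [_ + ->]]|]; first by rewrite IH => /eqP <-.
by case: ts => [|t l] //= [e]; exists (t, l); rewrite IH e.
Qed.

Lemma words_uniq m : uniq (words m).
Proof.
elim: m => // m IH; apply: allpairs_uniq => //; last by move=> [a b] [c d] _ _ [-> ->].
by rewrite /= !inE !negb_or; do ?[apply/andP; split] => //; apply/eqP.
Qed.

Lemma mem_grids n m g : (g \in grids n m) = (size g == n) && all (fun ts => size ts == m) g.
Proof.
elim: n g => [|n IH] g; first by rewrite inE; case: g.
apply/allpairsP/idP => [[[t l] /= [+ + ->]]|].
  by rewrite mem_words IH => /= -> /andP[/eqP -> ->]; rewrite eqxx.
case: g => [|t l] //= /and3P[e1 e2 e3]; exists (t, l).
by rewrite mem_words IH e2 e3 -eqSS e1.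
Qed.

Lemma grids_uniq n m : uniq (grids n m).
Proof.
elim: n => // n IH; apply: allpairs_uniq => //; first exact: words_uniq.
by move=> [a b] [c d] _ _ [-> ->].
Qed.

Section TilingGrid.
Variables n m : nat.
Implicit Type D : {ffun 'I_n * 'I_m -> tile}.

Definition tile_at D (i j : nat) : tile :=
  if insub i is Some i' then if insub j is Some j' then D (i', j') else Defs.Empty
  else Defs.Empty.

Lemma tile_atE D (i : 'I_n) (j : 'I_m) : tile_at D i j = D (i, j).
Proof. by rewrite /tile_at !valK. Qed.

Definition grid_of D : seq (seq tile) := mkseq (fun i => mkseq (tile_at D i) m) n.

Lemma sum_tilings (R : nmodType) (F : seq (seq tile) -> R) :
  \sum_D F (grid_of D) = \sum_(g <- grids n m) F g.
Proof.
rewrite -(big_map grid_of xpredT F) /=; apply: perm_big.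
have nthg D (i : 'I_n) (j : 'I_m) : nth Defs.Empty (nth [::] (grid_of D) i) j = D (i, j).
  by rewrite !nth_mkseq // tile_atE.
apply: uniq_perm; rewrite ?grids_uniq //.
  rewrite map_inj_uniq ?index_enum_uniq // => D D' e.
  by apply/ffunP => -[i j]; rewrite -!nthg e.
move=> g; rewrite mem_grids; apply/mapP/andP => [[D _ ->]|[/eqP sg /allP hg]].
  rewrite size_mkseq; split=> //; apply/allP => ts /mapP[i _ ->].
  by rewrite size_mkseq.
exists [ffun c : 'I_n * 'I_m => nth Defs.Empty (nth [::] g c.1) c.2].
  by rewrite mem_index_enum.
apply/esym; apply: (@eq_from_nth _ [::]); rewrite size_mkseq ?sg // => i hi.
rewrite nth_mkseq //.
have si : size (nth [::] g i) = m by apply/eqP/hg/mem_nth; rewrite sg.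
apply: (@eq_from_nth _ Defs.Empty); rewrite size_mkseq ?si // => j hj.
rewrite nth_mkseq //.
by rewrite -[i]/(val (Ordinal hi)) -[j]/(val (Ordinal hj)) tile_atE ffunE.
Qed.

End TilingGrid.

Lemma prow_fun (t : nat -> tile) (H T N : nat -> option int) m :
  (forall j, (j < m)%N -> tstep (t j) (H j) (T j) = Some (H j.+1, N j)) ->
  prow (mkseq t m) (H 0%N) (mkseq T m) = Some (H m, mkseq N m).
Proof.
elim: m t H T N => [|m IH] t H T N h //; rewrite !mkseq_cons /= h //.
by rewrite (IH _ (fun j => H j.+1) _ (fun j => N j.+1)) // => j; apply: (h j.+1).
Qed.

Lemma prow_ex (t : nat -> tile) (T : nat -> option int) h m e l :
  prow (mkseq t m) h (mkseq T m) = Some (e, l) ->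
  exists H N : nat -> option int, [/\ H 0%N = h, H m = e, l = mkseq N m &
    forall j, (j < m)%N -> tstep (t j) (H j) (T j) = Some (H j.+1, N j)].
Proof.
elim: m t T h e l => [|m IH] t T h e l.
  by case=> <- <-; exists (fun=> h), (fun=> None).
rewrite !mkseq_cons /=; case e1 : (tstep (t 0%N) h (T 0%N)) => [[E N0]|] //.
case e2 : (prow _ _ _) => [[e' l']|] // [<- <-].
have [H [N [H0 Hm -> hj]]] := IH _ _ _ _ _ e2.
exists (fun j => if j is j'.+1 then H j' else h), (fun j => if j is j'.+1 then N j' else N0).
by split=> //; [rewrite mkseq_cons | case=> [|j] // hj'; rewrite ?e1 ?H0 //; apply: hj].
Qed.

Lemma pgrid_fun (t : nat -> nat -> tile) (we so : nat -> nat -> option int) n m :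
  (forall i, (i < n)%N -> we i 0%N = None) ->
  (forall i j, (i < n)%N -> (j < m)%N ->
     tstep (t i j) (we i j) (so i.+1 j) = Some (we i j.+1, so i j)) ->
  pgrid (mkseq (fun i => mkseq (t i) m) n) (mkseq (so n) m) =
  Some (mkseq (fun i => we i m) n, mkseq (so 0%N) m).
Proof.
elim: n t we so => [|n IH] t we so w0 h //; rewrite !mkseq_cons /=.
rewrite (IH (fun i => t i.+1) (fun i => we i.+1) (fun i => so i.+1)); first last.
- by move=> i j hi hj; apply: h.
- by move=> i hi; apply: w0.
by rewrite -(w0 0%N) // (prow_fun _ _ _ (so 0%N)) // => j hj; apply: h.
Qed.

Lemma pgrid_ex (t : nat -> nat -> tile) (T : nat -> option int) n m es l :
  pgrid (mkseq (fun i => mkseq (t i) m) n) (mkseq T m) = Some (es, l) ->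
  exists we so : nat -> nat -> option int,
  [/\ forall i, (i < n)%N -> we i 0%N = None,
      so n = T, es = mkseq (fun i => we i m) n, l = mkseq (so 0%N) m &
      forall i j, (i < n)%N -> (j < m)%N ->
        tstep (t i j) (we i j) (so i.+1 j) = Some (we i j.+1, so i j)].
Proof.
elim: n t es l => [|n IH] t es l.
  by case=> <- <-; exists (fun _ _ => None), (fun=> T).
rewrite mkseq_cons /=; case e1 : (pgrid _ _) => [[es' l']|] //.
have [we [so [w0 sn -> el h]]] := IH _ _ _ e1; rewrite el.
case e2 : (prow _ _ _) => [[e l2]|] // [<- <-].
have [H [N [H0 Hm -> hj]]] := prow_ex _ _ _ _ _ _ e2.
exists (fun i => if i is i'.+1 then we i' else H), (fun i => if i is i'.+1 then so i' else N).
split=> //.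
- by case=> [|i] hi; [exact: H0 | apply: w0].
- by rewrite mkseq_cons Hm.
- by case=> [|i] j hi hj'; [apply: hj | apply: h].
Qed.

(** A crossing accepted by [tstep] involves two positive labels, so the nonpositive ones keep their
    order along the cut. *)
Lemma prow_nonpos ts h s e l : prow ts h s = Some (e, l) ->
  [seq p <- pmap id (l ++ [:: e]) | p <= 0] = [seq p <- pmap id (h :: s) | p <= 0].
Proof.
elim: ts h s e l => [|t ts IH] h [|T s] e l //=; first by case=> <- <-.
case e1 : (tstep t h T) => [[E N]|] //; case e2 : (prow ts E s) => [[e' l']|] // [<- <-].
have := IH _ _ _ _ e2; move: e1; case: t h T => -[p|] [q|] //=; rewrite ?if_same //.
all: rewrite /tstep /=; try by case=> <- <- /= ->.
case: ifP => // /andP[p0 q0] [<- <-] /=.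
rewrite !leNgt lt_max lt_min p0 q0 /= => ->.
by [].
Qed.

Lemma pgrid_nonpos g s es l : pgrid g s = Some (es, l) ->
  all (fun e => if e is Some p then 0 < p else false) es ->
  [seq p <- pmap id l | p <= 0] = [seq p <- pmap id s | p <= 0].
Proof.
elim: g es l => [|ts g IH] es l /=; first by case=> _ <-.
case r : (pgrid g s) => [[es' l']|] //; case r' : (prow ts None l') => [[e l2]|] // [<- <-] /=.
move=> /andP[e0 es0]; rewrite -(IH _ _ r es0); have := prow_nonpos _ _ _ _ _ r'.
rewrite pmap_cat filter_cat /= => <-; case: e e0 {r'} => [p|] //= p0.
by rewrite leNgt p0 cats0.
Qed.

(** * The global crossing rule agrees with the sorting of labels *)

Section Raster.
Variables (n m : nat) (t : nat -> nat -> tile) (we so : nat -> nat -> option int).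

(* The labels on the cut which separates the cells filled before [(i, j)] when
   the rows are filled from bottom to top, each from left to right. *)
Let cut i j k := if (k < j)%N then so i k else if k == j then we i j else so i.+1 k.-1.

Let before i' j' i j :=
  [&& (i' < n)%N, (j' < m)%N & (i < i')%N || (i' == i) && (j' < j)%N].

Let pair_at i' j' p q :=
  (we i' j', so i'.+1 j') = (Some p, Some q) \/ (we i' j', so i'.+1 j') = (Some q, Some p).

Let crossed i j p q := exists i' j', [/\ before i' j' i j, t i' j' = Cross & pair_at i' j' p q].

(** The second clause confines the past of a pipe to the columns weakly west of it; it turns
    [crossed], which knows only the order of filling, into the southwest condition of
    [already_crossed]. Position [k] of the cut belongs to column [k] for [k <= j] and to column
    [k - 1] beyond. *)
Definition raster_inv i j :=
  (forall k k' p q, (k < k')%N -> (k' <= m)%N -> cut i j k = Some p -> cut i j k' = Some q ->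
     p <> q /\ (q < p <-> crossed i j p q)) /\
  (forall k p i' j', (k <= m)%N -> cut i j k = Some p -> before i' j' i j ->
     we i' j' = Some p \/ so i'.+1 j' = Some p ->
     (j' <= (if (k <= j)%N then k else k.-1))%N).

Let tcut_in u W S E N p : tcut u W S = Some (E, N) -> E = Some p \/ N = Some p ->
  W = Some p \/ S = Some p.
Proof.
case: u W S => -[a|] [b|] //= [<- <-]; try by case; auto.
by rewrite /Num.min /Num.max; case: ltP => _ [] [<-]; auto.
Qed.

Let tcut_two u W S a b : tcut u W S = Some (Some a, Some b) ->
  u = Cross /\ exists p q, [/\ W = Some p, S = Some q, a = Num.min p q & b = Num.max p q].
Proof. by case: u W S => -[p|] [q|] //= [<- <-]; split=> //; exists p, q. Qed.

(** Only the positions [j] and [j + 1] of the cut change. [origin] traces each new label to an old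
    position, and any pair not leaving the cell together keeps its order and its crossings. *)
Lemma raster_inv_cell i j : (i < n)%N -> (j < m)%N ->
  tcut (t i j) (we i j) (so i.+1 j) = Some (we i j.+1, so i j) ->
  raster_inv i j -> raster_inv i j.+1.
Proof.
move=> hi hj loc [inv1 inv2].
have cW : cut i j j = we i j by rewrite /cut ltnn eqxx.
have cS : cut i j j.+1 = so i.+1 j by rewrite /cut ltnNge leqnSn /= gtn_eqF.
have cN : cut i j.+1 j = so i j by rewrite /cut ltnSn.
have cE : cut i j.+1 j.+1 = we i j.+1 by rewrite /cut ltnn eqxx.
have cO k : k <> j -> k <> j.+1 -> cut i j.+1 k = cut i j k.
  move=> k1 k2; rewrite /cut.
  by case: (ltngtP k j) => h1; case: (ltngtP k j.+1) => h2; try by []; exfalso; lia.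
have uniq_cut a b p : (a <= m)%N -> (b <= m)%N -> cut i j a = Some p -> cut i j b = Some p -> a = b.
  move=> ha hb ea eb; case: (ltngtP a b) => // h.
    by case: (inv1 _ _ _ _ h hb ea eb).
  by case: (inv1 _ _ _ _ h ha eb ea).
have origin k p : (k <= m)%N -> cut i j.+1 k = Some p -> exists o, [/\ (o <= m)%N,
    cut i j o = Some p, k = j \/ k = j.+1 -> o = j \/ o = j.+1 & k <> j -> k <> j.+1 -> o = k].
  move=> hk; case: (eqVneq k j) => [->|kj]; last case: (eqVneq k j.+1) => [->|kj1].
  - rewrite cN => e; case: (tcut_in _ _ _ _ _ p loc (or_intror e)) => e'.
      by exists j; rewrite cW; split; [lia | exact: e' | by left | lia].
    by exists j.+1; rewrite cS; split; [exact: hj | exact: e' | by right | lia].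
  - rewrite cE => e; case: (tcut_in _ _ _ _ _ p loc (or_introl e)) => e'.
      by exists j; rewrite cW; split; [lia | exact: e' | by left | lia].
    by exists j.+1; rewrite cS; split; [exact: hj | exact: e' | by right | lia].
  - have -> := cO k (elimN eqP kj) (elimN eqP kj1).
    by move=> e; exists k; split=> //; lia.
have beforeS i' j' : before i' j' i j.+1 -> before i' j' i j \/ (i' = i /\ j' = j).
  by rewrite /before; lia.
have before_mono i' j' : before i' j' i j -> before i' j' i j.+1.
  by rewrite /before; lia.
have here o p : (o <= m)%N -> cut i j o = Some p ->
    we i j = Some p \/ so i.+1 j = Some p -> o = j \/ o = j.+1.
  move=> ho eo [e|e]; [left | right]; apply: (uniq_cut _ _ p) => //; rewrite ?cW ?cS //; lia.
split=> [k k' p q kk hk' ek ek'|k p i' j' hk ek].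
  have hk : (k <= m)%N by lia.
  have [o [ho eo o1 o2]] := origin _ _ hk ek.
  have [o' [ho' eo' o1' o2']] := origin _ _ hk' ek'.
  (* If both labels leave the current cell, its tile is a crossing and they are decreasing from now
     on. *)
  have [[kj kj']|nk] := pselect (k = j /\ k' = j.+1).
    move: ek ek'; rewrite kj kj' cN cE => eN eE; move: loc; rewrite eN eE => loc.
    have [tC [p0 [q0 [eW eS eq ep]]]] := tcut_two _ _ _ _ _ loc.
    have [npq _] := inv1 j j.+1 p0 q0 (ltnSn j) hj (etrans cW eW) (etrans cS eS).
    have qp : q < p by rewrite eq ep; move: npq; case: (ltgtP p0 q0) => // ->.
    split; first by lia.
    split=> // _; exists i, j; split=> //; first by rewrite /before hi hj eqxx ltnSn orbT.
    rewrite /pair_at eW eS eq ep.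
    by case: (ltgtP p0 q0) npq => // _ _; [right | left].
  have oo : (o < o')%N by lia.
  have [npq h] := inv1 _ _ _ _ oo ho' eo eo'; split=> //; rewrite h.
  split=> -[i' [j' [b tc pa]]]; exists i', j'; split=> //; first exact: before_mono.
  case: (beforeS _ _ b) => [//|[ei ej]]; exfalso.
  have := here _ _ ho eo; have := here _ _ ho' eo'.
  by move: pa; rewrite /pair_at ei ej => -[[-> ->]|[-> ->]] h1 h2;
    have := h1 (ltac:(auto)); have := h2 (ltac:(auto)); lia.
have [o [ho eo o1 o2]] := origin _ _ hk ek.
move=> /beforeS [b|[-> ->]] h.
  by have := inv2 _ _ _ _ ho eo b h; do ![case: ifP]; lia.
by have := here _ _ ho eo h; case: ifP; lia.
Qed.

(** Between two rows the exit label drops off the east end of the cut and an empty west edge is put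
    in front, hence the shift of positions by one. *)
Lemma raster_inv_row i : we i 0%N = None -> raster_inv i.+1 m -> raster_inv i 0.
Proof.
move=> w0 [inv1 inv2].
have cE k p : (k <= m)%N -> cut i 0 k = Some p -> (0 < k)%N /\ cut i.+1 m k.-1 = Some p.
  by case: k => [|k] hk; rewrite /cut /= ?w0 // hk.
have bE i' j' : before i' j' i 0 = before i' j' i.+1 m.
  by rewrite /before; lia.
have xE p q : crossed i 0 p q = crossed i.+1 m p q.
  by apply/propext; split=> -[i' [j' [b ? ?]]]; exists i', j'; split=> //; rewrite ?bE // -bE.
split=> [k k' p q kk hk' ek ek'|k p i' j' hk ek].
  have hk : (k <= m)%N by lia.
  have [k0 e] := cE _ _ hk ek; have [k0' e'] := cE _ _ hk' ek'.
  by rewrite xE; apply: (inv1 k.-1 k'.-1) => //; lia.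
have [k0 e] := cE _ _ hk ek; rewrite bE => b h.
have hk1 : (k.-1 <= m)%N by lia.
by have := inv2 _ _ _ _ hk1 e b h; rewrite hk1 (_ : (k <= 0)%N = false) //; lia.
Qed.

Lemma raster_inv_start (c : nat -> int) : (forall j, (j < m)%N -> so n j = Some (c j)) ->
  {homo c : a b / (a < b)%N >-> a < b} -> (0 < n)%N -> we n.-1 0%N = None ->
  raster_inv n.-1 0.
Proof.
move=> sc cmono n0 w0.
have nob i' j' : before i' j' n.-1 0 = false by rewrite /before; lia.
have cE k p : (k <= m)%N -> cut n.-1 0 k = Some p -> (0 < k)%N /\ p = c k.-1.
  case: k => [|k] hk; rewrite /cut /= ?w0 // prednK // sc // => -[<-] //.
split=> [k k' p q kk hk' ek ek'|k p i' j' hk ek]; last by rewrite nob.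
have hk : (k <= m)%N by lia.
have [k0 ->] := cE _ _ hk ek; have [k0' ->] := cE _ _ hk' ek'.
have lt : c k.-1 < c k'.-1 by apply: cmono; lia.
split; first by lia.
by split=> [|[i' [j' []]]]; [lia | rewrite nob].
Qed.

(** The local rule at a cell may rely on the invariant there: for a labelling taken from
    [rect_KBPD], the invariant decides whether the two pipes have crossed, and so which way they
    leave. *)
Lemma raster_invP (c : nat -> int) : (forall j, (j < m)%N -> so n j = Some (c j)) ->
  {homo c : a b / (a < b)%N >-> a < b} -> (forall i, (i < n)%N -> we i 0%N = None) ->
  (forall i j, (i < n)%N -> (j < m)%N -> raster_inv i j ->
     tcut (t i j) (we i j) (so i.+1 j) = Some (we i j.+1, so i j)) ->
  forall i j, (i < n)%N -> (j <= m)%N -> raster_inv i j.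
Proof.
move=> sc cmono w0 loc.
have cells i : (i < n)%N -> raster_inv i 0 -> forall j, (j <= m)%N -> raster_inv i j.
  move=> hi h0; elim=> [|j IH] hj //; have h := IH (ltnW hj).
  by apply: raster_inv_cell => //; apply: loc.
suff h d i : (d = n.-1 - i)%N -> (i < n)%N -> raster_inv i 0.
  by move=> i j hi hj; apply: cells => //; apply: (h (n.-1 - i)%N).
elim: d i => [|d IH] i hd hi.
  have -> : i = n.-1 by lia.
  by apply: (raster_inv_start c) => //; [lia | apply: w0; lia].
apply: raster_inv_row; first exact: w0.
by apply: cells => //; [lia | apply: IH; lia].
Qed.

Lemma raster_inv_crossed i j p q : (i < n)%N -> (j < m)%N -> raster_inv i j ->
  we i j = Some p -> so i.+1 j = Some q ->
  p <> q /\ (q < p <-> exists i' j', [/\ (i' < n)%N /\ (j' < m)%N, (i', j') <> (i, j),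
     (i <= i')%N /\ (j' <= j)%N, t i' j' = Cross &
     (we i' j', so i'.+1 j') = (Some p, Some q) \/ (we i' j', so i'.+1 j') = (Some q, Some p)]).
Proof.
move=> hi hj [inv1 inv2] eW eS.
have cW : cut i j j = Some p by rewrite /cut ltnn eqxx.
have cS : cut i j j.+1 = Some q by rewrite /cut ltnNge leqnSn /= gtn_eqF.
have [npq h] := inv1 _ _ _ _ (ltnSn j) hj cW cS; split=> //; rewrite h.
split=> -[i' [j']].
  move=> [b tc pa]; exists i', j'; split=> //.
  - by move: b; rewrite /before; lia.
  - by case=> ei ej; move: b; rewrite ei ej /before; lia.
  - split; first by move: b; rewrite /before; lia.
    have := inv2 _ _ i' j' (ltnW hj) cW b; rewrite leqnn; apply.
    by case: pa => -[-> ->]; auto.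
move=> [[hi' hj'] ne [ii jj] tc pa]; exists i', j'; split=> //.
rewrite /before hi' hj' /=; case: (ltngtP i i') ii => // ei _ /=.
by rewrite ltn_neqAle jj andbT; apply/eqP => ej; apply: ne; rewrite ei ej.
Qed.

End Raster.

Section RectLabels.
Variable n : nat.
Variable D : tiling n.

Let col (j : nat) : int := j%:Z + 1 - n%:Z.

Let col_mono : {homo col : a b / (a < b)%N >-> a < b}.
Proof. by move=> a b; rewrite /col; lia. Qed.

Lemma already_crossedP (west south : labels) (we so : nat -> nat -> option int) :
  (forall i j, (i < n)%N -> (j < n.*2)%N -> west i.+1%:Z (col j) = we i j) ->
  (forall i j, (i < n)%N -> (j < n.*2)%N -> south i.+1%:Z (col j) = so i.+1 j) ->
  forall (i : 'I_n) (j : 'I_(n.*2)) p q,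
  raster_inv n n.*2 (tile_at n n.*2 D) we so i j ->
  we i j = Some p -> so i.+1 j = Some q ->
  p <> q /\ (already_crossed D west south (i, j) <-> q < p).
Proof.
move=> hw hs i j p q inv eW eS.
have [npq h] := raster_inv_crossed _ _ _ _ _ i j p q (ltn_ord i) (ltn_ord j) inv eW eS.
split=> //; rewrite h; split.
  move=> [[i' j'] /= [ne ii jj Dc]].
  rewrite [west _ _](hw i' j') // [south _ _](hs i' j') //.
  rewrite [west _ _](hw i j) // [south _ _](hs i j) // eW eS => pr.
  exists i', j'; split=> //; last by rewrite tile_atE.
  by case=> ei ej; move/eqP: ne; apply; congr pair; apply: val_inj.
move=> [i' [j' [[hi hj] ne [ii jj] tc pr]]].
exists (Ordinal hi, Ordinal hj); split=> //=.
- by apply/eqP => -[ei ej]; apply: ne; rewrite -ei -ej.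
- by rewrite -tile_atE.
rewrite [west _ _](hw i' j') // [south _ _](hs i' j') //.
by rewrite [west _ _](hw i j) // [south _ _](hs i j) // eW eS.
Qed.

(** The local form of [rect_KBPD]. Index [i] is row [i + 1], and [so i] labels the north edges of
    that row. *)
Definition rect_labels (w : int -> int) (we so : nat -> nat -> option int) : Prop :=
  [/\ forall i, (i < n)%N -> we i 0%N = None,
      forall j, (j < n.*2)%N -> so n j = Some (col j),
      forall i, (i < n)%N -> we i n.*2 = Some (w i.+1%:Z),
      forall j p, (j < n.*2)%N -> so 0%N j = Some p -> p <= 0 &
      forall i j, (i < n)%N -> (j < n.*2)%N ->
        tstep (tile_at n n.*2 D i j) (we i j) (so i.+1 j) = Some (we i j.+1, so i j)].

Lemma tstep_tcut t W T x : tstep t W T = Some x -> tcut t W T = Some x.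
Proof. by case: t => //=; case: ifP. Qed.

Lemma rect_KBPDP w : rect_KBPD w D <-> exists we so, rect_labels w we so.
Proof.
have colS j : col j + 1 = col j.+1 by rewrite /col; lia.
have rowB i : i.+1%:Z - 1 = i%:Z by lia.
split.
  move=> [west [south [rule [hS hW hE hN hC]]]].
  pose we i j := west i.+1%:Z (col j); pose so i j := south i%:Z (col j).
  have cellE (i : 'I_n) (j : 'I_(n.*2)) : tile_rule (D (i, j)) (already_crossed D west south (i, j))
      (we i j) (so i.+1 j) (we i j.+1) (so i j).
    by have := rule (i, j); rewrite /= /rowZ /colZ -/(col j) colS rowB.
  have w0 i : (i < n)%N -> we i 0%N = None.
    by move=> hi; rewrite -(hW (Ordinal hi)) /we /rowZ /col add0r.
  have sn j : (j < n.*2)%N -> so n j = Some (col j) by move=> hj; apply: (hS (Ordinal hj)).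
  have loc i j : (i < n)%N -> (j < n.*2)%N -> raster_inv n n.*2 (tile_at n n.*2 D) we so i j ->
      tcut (tile_at n n.*2 D i j) (we i j) (so i.+1 j) = Some (we i j.+1, so i j).
    move=> hi hj; have := cellE (Ordinal hi) (Ordinal hj); rewrite /= -tile_atE /=.
    have := already_crossedP west south we so (fun _ _ _ _ => erefl) (fun _ _ _ _ => erefl)
      (Ordinal hi) (Ordinal hj); rewrite /=.
    case: (tile_at n n.*2 D i j) => /= ac.
    + by case=> -> -> -> ->.
    + by case=> p [-> -> -> ->].
    + by case=> p [-> -> -> ->].
    + by case=> p [-> -> -> ->].
    + by case=> p [-> -> -> ->].
    case=> p [q [eW eS c1 c2]] inv; rewrite eW eS; have [npq h] := ac _ _ inv eW eS.
    case: (ltgtP p q) npq => // pq _.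
      by have [-> ->] := c2 (fun a => ltac:(have := h.1 a; lia)).
    by have [-> ->] := c1 (h.2 pq).
  have inv := raster_invP _ _ _ _ _ _ sn col_mono w0 loc.
  exists we, so; split=> //.
  - move=> i hi; rewrite /we.
    have -> : col n.*2 = n%:Z + 1 by rewrite /col; lia.
    exact: (hE (Ordinal hi)).
  - by move=> j p hj; apply: (hN (Ordinal hj)).
  move=> i j hi hj; have := loc i j hi hj (inv _ _ hi (ltnW hj)).
  have := hC (Ordinal hi, Ordinal hj); rewrite -tile_atE /=.
  case: (tile_at n n.*2 D i j) => //= pos.
  suff [-> ->] : positive (we i j) /\ positive (so i.+1 j) by [].
  have e1 : west (rowZ (Ordinal hi)) (colZ (Ordinal hj)) = we i j by [].
  have e2 : south (rowZ (Ordinal hi)) (colZ (Ordinal hj)) = so i.+1 j by [].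
  split.
    by case e : (we i j) => [p|] //=; apply: (pos p) => //; left; rewrite e1.
  by case e : (so i.+1 j) => [p|] //=; apply: (pos p) => //; right; rewrite e2.
move=> [we [so [w0 sn hE hN loc]]].
pose west (r k : int) := we `|r - 1|%N `|(k - 1 + n%:Z)%R|%N.
pose south (r k : int) := so `|r|%N `|(k - 1 + n%:Z)%R|%N.
have colK j : `|(col j - 1 + n%:Z)%R|%N = j by rewrite /col; lia.
have hw i j : west i.+1%:Z (col j) = we i j.
  by rewrite /west colK; congr we; lia.
have hs i j : south i%:Z (col j) = so i j by rewrite /south colK.
have inv := raster_invP _ _ _ _ _ _ sn col_mono w0
  (fun i j hi hj _ => tstep_tcut _ _ _ _ (loc i j hi hj)).
have ac := already_crossedP west south we so (fun i j _ _ => hw i j) (fun i j _ _ => hs i.+1 j).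
exists west, south; split.
  move=> [i j] /=; rewrite /rowZ /colZ -/(col j) colS rowB !hw !hs.
  have := tstep_tcut _ _ _ _ (loc i j (ltn_ord i) (ltn_ord j)); rewrite tile_atE.
  have := ac i j _ _ (inv i j (ltn_ord i) (ltnW (ltn_ord j))).
  case: (D (i, j)) (we i j) (so i.+1 j) => -[p|] [q|] //= h [<- <-]; try (by exists p);
    try (by exists q); try by [].
  exists p, q; have [npq hpq] := h p q erefl erefl; split=> // c.
    by have := hpq.1 c; case: ltgtP.
  by case: (ltgtP p q) npq c => // pq _ c; case: c; apply: hpq.2.
split.
- by move=> j; rewrite [south _ _]hs sn.
- move=> i; have -> : 1 - n%:Z = col 0 by rewrite /col add0r.
  by rewrite [west _ _]hw w0.
- move=> i; have -> : n%:Z + 1 = col n.*2 by rewrite /col; lia.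
  by rewrite [west _ _]hw hE.
- by move=> j p; rewrite [south _ _](hs 0%N); apply: hN.
move=> [i j] p /= Dc; rewrite [west _ _]hw [south _ _](hs i.+1).
have := loc i j (ltn_ord i) (ltn_ord j); rewrite tile_atE Dc /=; case: ifP => // /andP[].
by case: (we i j) => [a|] /=; case: (so i.+1 j) => [b|] //= h1 h2 _ [[]|[]] // <-.
Qed.

End RectLabels.

(** * Grassmannian permutations *)

Section PartitionPerm.
Variables (n : nat) (lam : seq nat).
Hypothesis lam_decr : forall i k, (i <= k)%N -> (k < size lam)%N -> (nth 0%N lam k <= nth 0%N lam i)%N.
Hypothesis lam_le : forall i, (nth 0%N lam i <= n)%N.

Let row_word i : seq int := [seq j%:Z - i%:Z | j <- rev (iota 0 (nth 0%N lam i))].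
Let prefix_word k := flatten (rev [seq row_word i | i <- iota 0 k]).
Let prefix k := word_perm (prefix_word k).

(** The cycle to which the simple transpositions of row [i] multiply. *)
Let row_perm (i L : nat) (k : int) : int :=
  if k == - i%:Z then L%:Z - i%:Z
  else if (- i%:Z < k) && (k <= L%:Z - i%:Z) then k - 1 else k.

Let row_wordE i k : word_perm (row_word i) k = row_perm i (nth 0%N lam i) k.
Proof.
rewrite /row_word; elim: (nth 0%N lam i) => [|L IH].
  by rewrite /row_perm /=; do ![case: ifP]; lia.
rewrite -addn1 iotaD cats1 rev_rcons /= add0n IH /row_perm /s_.
by do ![case: ifP]; lia.
Qed.

Let prefixS k j : prefix k.+1 j = row_perm k (nth 0%N lam k) (prefix k j).
Proof.
rewrite /prefix /prefix_word -addn1 iotaD map_cat cats1 rev_rcons /= word_perm_cat add0n.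
by rewrite /= row_wordE.
Qed.

(** Row [k] moves only values between [- k] and [lam_k - k]; the values placed by earlier rows lie
    above these because [lam] decreases. *)
Let prefix_nonpos k (i : nat) : (k <= size lam)%N ->
  prefix k (- i%:Z) = if (i < k)%N then (nth 0%N lam i)%:Z - i%:Z else - i%:Z.
Proof.
elim: k i => [|k IH] i hk //; rewrite prefixS IH ?(ltnW hk) // /row_perm.
have [->|ik] := eqVneq i k; first by do ![case: ifP]; lia.
by have := lam_decr i k; do ![case: ifP]; lia.
Qed.

Let prefix_pos k (a b : int) : 0 < a < b -> - k%:Z < prefix k a < prefix k b.
Proof.
move=> ab; elim: k => [|k IH]; first by rewrite oppr0.
by rewrite !prefixS; move: IH; rewrite /row_perm; do ![case: ifP]; lia.
Qed.

Let prefix_big k (j : int) : n%:Z < j -> prefix k j = j.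
Proof.
move=> hj; elim: k => [|k IH] //; rewrite prefixS IH /row_perm.
by have := lam_le k; do ![case: ifP]; lia.
Qed.

Lemma w_part_nonpos (i : nat) : w_part lam (- i%:Z) =
  if (i < size lam)%N then (nth 0%N lam i)%:Z - i%:Z else - i%:Z.
Proof. exact: prefix_nonpos. Qed.

Lemma w_part_pos (a b : int) : 0 < a -> a < b -> w_part lam a < w_part lam b.
Proof. by move=> a0 ab; have := prefix_pos (size lam) a b; rewrite a0 ab => /(_ isT) /andP[]. Qed.

Lemma w_part_in_box : size lam = n -> in_box n n (w_part lam).
Proof.
move=> sl; split; first exact: word_perm_bij.
move=> i hi; case: (ltP n%:Z i) => h; first exact: prefix_big.
have -> : i = - (`|i|%N)%:Z by lia.
by rewrite w_part_nonpos; case: ifP; lia.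
Qed.

Lemma w_part_nonpos_lt (a b : int) : a < b -> b <= 0 -> w_part lam a < w_part lam b.
Proof.
move=> ab b0; have -> : a = - (`|a|%N)%:Z by lia.
have -> : b = - (`|b|%N)%:Z by lia.
rewrite !w_part_nonpos; have := lam_decr `|b|%N `|a|%N; do ![case: ifP]; lia.
Qed.

(** The word has one letter per box, and the length has the parity of any word. Translation by [n]
    brings the contents into [[1, 2n - 1]], the generators of the permutations of [{1, ..., 2n}]. *)
Lemma odd_len_w_part : size lam = n -> odd (len (w_part lam)) = odd (sumn lam).
Proof.
move=> sl; pose u := prefix_word (size lam).
have su : size u = sumn lam.
  rewrite /u /prefix_word size_flatten /shape map_rev sumn_rev -map_comp.
  congr sumn; rewrite -[RHS](mkseq_nth 0%N); apply: eq_map => i /=.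
  by rewrite size_map size_rev size_iota.
rewrite -(len_gamma n%:Z) -su -(size_map (fun i => i + n%:Z)).
have -> : gamma n%:Z (w_part lam) = word_perm [seq i + n%:Z | i <- u].
  by apply/funext => k; rewrite word_perm_shift.
apply: (odd_len_word n.*2); apply/allP => _ /mapP[c /flattenP[r + +] ->].
rewrite mem_rev => /mapP[i]; rewrite mem_iota => hi -> /mapP[j].
rewrite mem_rev mem_iota => hj ->; have := lam_le i; lia.
Qed.

End PartitionPerm.

Lemma size_path_part c b : size (path_part c b) = count id b.
Proof. by elim: b c => [|[] b IH] c //=; rewrite IH. Qed.

Lemma path_part_le c b i : (nth 0%N (path_part c b) i <= c)%N.
Proof.
elim: b c i => [|[] b IH] c i /=; first by rewrite nth_nil.
  by case: i => [|i] //=.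
by apply: leq_trans (IH _ _) (leq_pred c).
Qed.

Lemma path_part_decr c b i k : (i <= k)%N -> (k < size (path_part c b))%N ->
  (nth 0%N (path_part c b) k <= nth 0%N (path_part c b) i)%N.
Proof.
elim: b c i k => [|[] b IH] c i k //=; last exact: IH.
case: i k => [|i] [|k] //= ik hk; first exact: path_part_le.
exact: IH.
Qed.

Lemma path_part_col (f : int -> int) rl c i pre :
  count (pred1 None) rl = c -> size pre = i ->
  pmap id rl = [seq - k%:Z | k <- iota i (count isSome rl)] ->
  (forall i', (i' < size (pre ++ path_part c (map isSome rl)))%N ->
     f (- i'%:Z) = (nth 0%N (pre ++ path_part c (map isSome rl)) i')%:Z - i'%:Z) ->
  forall j k, nth None rl j = Some k -> f k = c%:Z - i%:Z - j%:Z.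
Proof.
elim: rl c i pre => [|[k0|] rl IH] c i pre; first by move=> _ _ _ _ j k; rewrite nth_nil.
  rewrite /= add0n => ec sp [ek ep] hf [|j] k /=.
    case=> <-; rewrite ek hf; last by rewrite size_cat /= sp; lia.
    by rewrite nth_cat sp ltnn subnn /= subr0.
  move=> ej; rewrite (IH c i.+1 (rcons pre c) _ _ _ _ j k ej) //; first lia.
  - by rewrite size_rcons sp.
  - by move=> i'; rewrite cat_rcons; apply: hf.
rewrite /= add1n => ec sp ep hf [|j] k //= ej.
case: c ec hf => // c [ec] /= hf.
by rewrite (IH c i pre _ _ _ _ j k ej) //; lia.
Qed.

Lemma pmap_id_rev (l : seq (option int)) : pmap id (rev l) = rev (pmap id l).
Proof.
elim: l => [|a l IH] //; rewrite rev_cons -cats1 pmap_cat IH.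
by case: a => [a|] /=; rewrite ?cats0 // rev_cons cats1.
Qed.

Lemma rev_ints_nonpos n : rev (ints (1 - n%:Z) n) = [seq - k%:Z | k <- iota 0 n].
Proof.
apply: (@eq_from_nth _ 0); rewrite size_rev size_ints ?size_map ?size_iota // => i hi.
rewrite nth_rev ?size_ints // (nth_map 0%N) ?size_iota; last lia.
by rewrite (nth_map 0%N) ?size_iota // !nth_iota; lia.
Qed.

Section NorthLabels.
Variables (n : nat) (l : seq (option int)).
Hypothesis size_l : size l = n.*2.
Hypothesis pmap_l : pmap id l = ints (1 - n%:Z) n.

Let lam := path_part n (rev (map isSome l)).

Let count_l : count isSome l = n.
Proof. by rewrite -(size_pmap id) pmap_l size_ints. Qed.

Lemma size_north_part : size lam = n.
Proof. by rewrite /lam size_path_part count_rev count_map -[RHS]count_l; apply: eq_count => -[]. Qed.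

Lemma north_col j k : nth None l j = Some k -> w_part lam k = j%:Z + 1 - n%:Z.
Proof.
move=> e; have jl : (j < n.*2)%N.
  by rewrite -size_l ltnNge; apply/negP => /(nth_default None); rewrite e.
have er : nth None (rev l) (n.*2 - j.+1) = Some k.
  have ej : (n.*2 - (n.*2 - j.+1).+1)%N = j by lia.
  by rewrite nth_rev size_l ?ej //; lia.
have cN : count (pred1 None) (rev l) = n.
  rewrite count_rev; have := count_predC isSome l; rewrite count_l size_l -addnn.
  by move/addnI => <-; apply: eq_count => -[].
rewrite (path_part_col (w_part lam) (rev l) n 0 [::] cN erefl _ _ _ _ er) ?subr0; first lia.
  by rewrite pmap_id_rev pmap_l rev_ints_nonpos count_rev count_l.
move=> i; rewrite cat0s map_rev -/lam => hi; rewrite w_part_nonpos ?hi //.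
by move=> a b; apply: path_part_decr.
Qed.

End NorthLabels.

Section GrassmannianGrid.
Variable R : comNzRingType.

Definition holes (A : seq int) (s : seq int) : seq (option int) :=
  [seq if j \in A then None else Some j | j <- s].

(** Row [m] takes out [f m], and the rows below have taken out larger labels only. Hence all columns
    west of [f m] still hold their own labels, and the row is forced with weight 1. *)
Lemma grid_sum_grassmannian (f : int -> int) (X : int -> R) lo N n Bs K :
  (forall a b, 0 < a -> a < b -> f a < f b) ->
  (forall i, 1 <= i <= n%:Z -> f i \in ints lo N) -> size Bs = N ->
  grid_sum R [seq (X i, Some (f i)) | i <- ints 1 n] Bs K [seq Some j | j <- ints lo N] =
  K (holes [seq f i | i <- ints 1 n] (ints lo N)).
Proof.
move=> finc fin sB.
suff h m : (m <= n)%N -> grid_sum R [seq (X i, Some (f i)) | i <- ints 1 m] Bs K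
    (holes [seq f i | i <- ints (m%:Z + 1) (n - m)] (ints lo N)) =
    K (holes [seq f i | i <- ints 1 n] (ints lo N)).
  rewrite -(h n (leqnn n)) subnn; congr grid_sum.
elim: m => [|m IH] mn; first by rewrite subn0 add0r.
rewrite ints_rcons map_rcons grid_sum_rcons -(IH (ltnW mn)).
have := fin (1 + m%:Z); rewrite mem_ints => hf.
have [|a [b [Nab ea ->]]] := ints_split lo N (f (1 + m%:Z)); first by apply: hf; lia.
set v := f (1 + m%:Z) in ea *; set A := [seq f i | i <- ints (m.+1%:Z + 1) _].
have Av c : c \in A -> v < c.
  by move=> /mapP[i]; rewrite mem_ints => hi ->; apply: finc; lia.
have -> : [seq f i | i <- ints (m%:Z + 1) (n - m)] = v :: A.
  have -> : (n - m)%N = (n - m.+1).+1 by lia.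
  by rewrite ints_cons /= /v /A addrC; congr (_ :: map _ (ints _ _)); lia.
rewrite /holes !map_cat /= mem_head.
have -> : v \in A = false by apply/negP => /Av; rewrite ltxx.
have e1 (C : seq int) : (forall c : int, c \in C -> v <= c) ->
    [seq (if j \in C then None else Some j) | j <- ints lo a] = [seq Some j | j <- ints lo a].
  move=> Cv; apply/eq_in_map => j; rewrite mem_ints => hj.
  by case: ifP => // /Cv; lia.
have e2 : [seq (if j \in v :: A then None else Some j) | j <- ints (v + 1) b] =
    [seq (if j \in A then None else Some j) | j <- ints (v + 1) b].
  apply/eq_in_map => j; rewrite mem_ints inE => hj.
  by case: eqP => // ej; move: hj; lia.
rewrite (e1 A) => [|c /Av /ltW //]; rewrite (e1 (v :: A)); last first.
  by move=> c; rewrite inE => /orP[/eqP-> //|/Av /ltW].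
rewrite e2; apply: row_sum_forced.
- by rewrite size_cat /= !size_map !size_iota sB Nab.
- by apply/allP => c; rewrite mem_ints; lia.
apply/allP => c; rewrite mem_pmap map_id => /mapP[j]; rewrite mem_ints => hj.
by case: ifP => // _ [->]; lia.
Qed.

Lemma gwt_prod n m (D : {ffun 'I_n * 'I_m -> tile}) (X B : nat -> R) :
  gwt R (mkseq X n) (mkseq B m) (grid_of n m D) = \prod_(c : 'I_n * 'I_m) twt R (X c.1) (B c.2) (D c).
Proof.
have rE Y (C : nat -> R) (t : nat -> tile) k :
    rwt R Y (mkseq C k) (mkseq t k) = \prod_(j < k) twt R Y (C j) (t j).
  elim: k C t => [|k IH] C t; first by rewrite /rwt big_nil big_ord0.
  by rewrite !mkseq_cons /rwt /= big_cons big_ord_recl; congr (_ * _); apply: IH.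
have gE (Y : nat -> R) Bs (g : nat -> seq tile) k :
    gwt R (mkseq Y k) Bs (mkseq g k) = \prod_(i < k) rwt R (Y i) Bs (g i).
  elim: k Y g => [|k IH] Y g; first by rewrite big_ord0.
  by rewrite !mkseq_cons /= big_ord_recl IH.
rewrite gE [RHS](eq_bigr (fun c : 'I_n * 'I_m => twt R (X c.1) (B c.2) (D (c.1, c.2)))); last first.
  by case.
rewrite -(pair_big xpredT xpredT (fun (i : 'I_n) (j : 'I_m) => twt R (X i) (B j) (D (i, j)))) /=.
by apply: eq_bigr => i _; rewrite rE; apply: eq_bigr => j _; rewrite tile_atE.
Qed.

End GrassmannianGrid.

Lemma tile_weight (A : comNzRingType) (t : tile) (a b : A) :
  (if t == Defs.Empty then a else 1) * (if t == ElbowNW then b else 1) =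
  match t with Defs.Empty => a | ElbowNW => b | _ => 1 end.
Proof. by case: t; do ?[case: eqP => //]; rewrite ?mulr1 ?mul1r. Qed.

Lemma wt_gwt n (D : tiling n) :
  wt D = gwt series [seq 1 - x_ i | i <- ints 1 n] (sq_cols (1 - n%:Z) n.*2) (grid_of n n.*2 D).
Proof.
have eX : [seq 1 - x_ i | i <- ints 1 n] = mkseq (fun i => 1 - x_ i.+1%:Z) n.
  by rewrite /ints -map_comp; apply: eq_map => i /=; congr (1 - x_ _); lia.
have eB : sq_cols (1 - n%:Z) n.*2 = mkseq (fun j => geom (inr (j%:Z + 1 - n%:Z))) n.*2.
  by rewrite /sq_cols /ints -map_comp; apply: eq_map => i /=; congr (geom (inr _)); lia.
rewrite eX eB gwt_prod /wt big_mkcond [X in _ * X]big_mkcond -big_split.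
apply: eq_bigr => c _.
refine (etrans (tile_weight _ (D c) _ _) _).
case: (D c) => //=.
  exact: ominusN.
exact: ominusC.
Qed.

Lemma north_tile t W T E N : tstep t W T = Some (E, N) ->
  (t \in [:: ElbowNW; Vert; Cross]) = isSome N.
Proof.
have iN u : (u \in [:: ElbowNW; Vert; Cross]) =
    match u with ElbowNW | Vert | Cross => true | _ => false end.
  by case: u; rewrite !inE; do ?[case: eqP => //].
by rewrite iN => /tstep_tcut; case: t W T => -[p|] [q|] //= [_ <-].
Qed.

Lemma lambdaE n (D : tiling n) w we so : rect_labels n D w we so ->
  lambda D = path_part n (rev (map isSome (mkseq (so 0%N) n.*2))).
Proof.
move=> [_ _ _ _ loc]; rewrite /lambda map_rev; congr (path_part _ (rev _)).
rewrite /mkseq -val_enum_ord -!map_comp; apply: eq_map => j /=.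
have n0 : (0 < n)%N by have := ltn_ord j; lia.
have := north_tile _ _ _ _ _ (loc 0%N j n0 (ltn_ord j)).
rewrite -[0%N]/(val (Ordinal n0)) tile_atE => <-.
apply/existsP/idP => [[i /andP[/eqP i0]]|h].
  by have -> : i = Ordinal n0 by apply: val_inj.
by exists (Ordinal n0); rewrite eqxx.
Qed.

(** * The expansion of a finite square and the passage to the limit *)

Lemma in_box_range m n w i : in_box m n w -> 1 - m%:Z <= i <= n%:Z -> 1 - m%:Z <= w i <= n%:Z.
Proof.
move=> [/bij_inj winj wid] hi; apply: contraT => h.
by have e := winj _ _ (wid _ h); rewrite e hi in h.
Qed.

Lemma sq_sum_split n d v : let lo := 1 - n%:Z - d%:Z in
  sq_sum lo (d + n.*2) v =
  grid_sum series (sq_rows 1 n v) (sq_cols lo (d + n.*2))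
    (grid_sum series (sq_rows lo (d + n) v) (sq_cols lo (d + n.*2)) (no_pipe series))
    [seq Some j | j <- ints lo (d + n.*2)].
Proof.
move=> lo; have eI : sq_rows lo (d + n.*2) v = sq_rows lo (d + n) v ++ sq_rows 1 n v.
  rewrite -addnn addnA /sq_rows ints_cat map_cat; congr (_ ++ map _ (ints _ _)).
  by rewrite /lo; lia.
by rewrite /sq_sum eI grid_sum_cat.
Qed.

(** In the square of the Grassmannian permutation [f], the forced rows pass upwards the labels [l]
    with each [k] replaced by its column [f k], and this replacement preserves the order. *)
Lemma sq_sum_north n d l : let lo := 1 - n%:Z - d%:Z in
  size l = n.*2 -> pmap id l = ints (1 - n%:Z) n ->
  grid_sum series (sq_rows lo (d + n) id) (sq_cols lo (d + n.*2)) (no_pipe series)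
    ([seq Some j | j <- ints lo d] ++ l) =
  sq_sum lo (d + n.*2) (w_part (path_part n (rev (map isSome l)))).
Proof.
move=> lo sl pl; set lam := path_part _ _; set f := w_part lam.
have lam_decr i k : (i <= k)%N -> (k < size lam)%N -> (nth 0%N lam k <= nth 0%N lam i)%N.
  exact: path_part_decr.
have lam_le i : (nth 0%N lam i <= n)%N by apply: path_part_le.
have fB : in_box n n f by apply: w_part_in_box => //; apply: size_north_part.
have finj := bij_inj fB.1.
have fle x : x <= 0 -> f x <= n%:Z.
  move=> x0; case: (boolP (1 - n%:Z <= x <= n%:Z)) => h; last by rewrite fB.2 //; lia.
  by have := in_box_range _ _ _ _ fB h; lia.
(* Only nonpositive labels occur here; the values [k + n] make [f'] increasing on all integers,
   since [f] is at most [n] on the nonpositive ones. *)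
pose f' (k : int) := if k <= 0 then f k else k + n%:Z.
have f'mono : {mono f' : x y / x <= y}.
  apply: le_mono => x y xy; rewrite /f'; case: (leP x 0) => x0; case: (leP y 0) => y0; try lia.
    exact: w_part_nonpos_lt.
  by have := fle x x0; lia.
pose A := [seq f i | i <- ints 1 n].
have notA j : j <= 0 -> f j \notin A.
  by move=> j0; apply/mapP => -[i]; rewrite mem_ints => hi /finj; lia.
have labE : [seq omap f' a | a <- [seq Some j | j <- ints lo d] ++ l] =
    holes A (ints lo (d + n.*2)).
  rewrite ints_cat /holes !map_cat -map_comp; congr (_ ++ _).
    apply/eq_in_map => j; rewrite mem_ints => hj /=.
    have fj : f j = j by apply: fB.2; lia.
    have j0 : j <= 0 by lia.
    by have := notA j j0; rewrite /f' j0 fj => /negPf ->.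
  have -> : lo + d%:Z = 1 - n%:Z by rewrite /lo; lia.
  apply: (@eq_from_nth _ None); rewrite !size_map ?size_iota ?sl // => j hj.
  have nE : nth 0 (ints (1 - n%:Z) n.*2) j = j%:Z + 1 - n%:Z.
    by rewrite (nth_map 0%N) ?size_iota // nth_iota //; lia.
  rewrite (nth_map None) ?sl // (nth_map 0) ?size_ints // nE.
  case e : (nth None l j) => [k|] /=.
    have kl : k \in pmap id l.
      by rewrite mem_pmap map_id -e mem_nth // sl.
    have k0 : k <= 0 by move: kl; rewrite pl mem_ints; lia.
    have fk : f k = j%:Z + 1 - n%:Z by apply: (north_col n l sl pl).
    by have := notA k k0; rewrite /f' k0 fk => /negPf ->.
  (* The column is [f i] for some [i] in the box. A nonpositive [i] would be a label of [l] standing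
     in this very column, which is empty. *)
  suff -> : j%:Z + 1 - n%:Z \in A by [].
  have [g gf fg] := fB.1; set c := j%:Z + 1 - n%:Z; pose i := g c.
  have fi : f i = c by rewrite /i fg.
  have hi : 1 - n%:Z <= i <= n%:Z.
    by apply: contraT => h; have := fB.2 _ h; rewrite fi => ic; move: h; rewrite -ic /c; lia.
  have [i1|i0] := lerP 1 i; first by apply/mapP; exists i; rewrite // mem_ints; lia.
  have : i \in pmap id l by rewrite pl mem_ints; lia.
  rewrite mem_pmap map_id => /(nthP None)[j' hj' e'].
  have := north_col n l sl pl _ _ e'; rewrite -/lam -/f fi /c => ej.
  have jj : j' = j by lia.
  by rewrite jj e in e'.
rewrite sq_sum_split -/lo.
rewrite (grid_sum_grassmannian series f (fun i => 1 - x_ i)); first last.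
- by rewrite size_sq_cols.
- move=> i hi; rewrite mem_ints.
  by have := in_box_range n n f i fB; rewrite /lo; lia.
- by move=> a b a0 ab; apply: w_part_pos.
rewrite -/A -labE.
have npE : no_pipe series = fun l' => no_pipe series [seq omap f' a | a <- l'].
  apply/funext => l'; rewrite /no_pipe all_map; congr ((nat_of_bool _)%:R).
  by apply: eq_all => -[a|].
rewrite [in LHS]npE -(grid_sum_relabel series f' f'mono); congr grid_sum.
rewrite /sq_rows -map_comp; apply/eq_in_map => i; rewrite mem_ints => hi /=.
by congr (_, Some _); rewrite /f'; case: ifP => //; rewrite /lo in hi; lia.
Qed.

Lemma rect_labels_north n (D : tiling n) w we so : in_S n w -> rect_labels n D w we so ->
  pgrid (grid_of n n.*2 D) [seq Some j | j <- ints (1 - n%:Z) n.*2] =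
    Some (mkseq (fun i => Some (w i.+1%:Z)) n, mkseq (so 0%N) n.*2) /\
  pmap id (mkseq (so 0%N) n.*2) = ints (1 - n%:Z) n.
Proof.
move=> wS [l0 ln lE lN loc].
have soE : mkseq (so n) n.*2 = [seq Some j | j <- ints (1 - n%:Z) n.*2].
  rewrite /ints -map_comp; apply/eq_in_map => j; rewrite mem_iota => hj /=.
  by rewrite ln //; congr Some; lia.
have esE : mkseq (fun i => we i n.*2) n = mkseq (fun i => Some (w i.+1%:Z)) n.
  by apply/eq_in_map => i; rewrite mem_iota => hi; apply: lE.
have pE := pgrid_fun _ _ _ _ _ l0 loc; rewrite soE esE in pE; split=> //.
have nonpos : all (fun p => p <= 0) (pmap id (mkseq (so 0%N) n.*2)).
  apply/allP => p; rewrite mem_pmap map_id => /mapP[j]; rewrite mem_iota => hj e.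
  by apply: (lN j) => //; rewrite -e.
rewrite -[LHS](all_filterP nonpos) (pgrid_nonpos _ _ _ _ pE); last first.
  apply/allP => e /mapP[i]; rewrite mem_iota => hi ->.
  by have := in_S_range n w i.+1%:Z wS; lia.
rewrite map_pK // -addnn ints_cat filter_cat.
have /all_filterP -> : all (fun p => p <= 0) (ints (1 - n%:Z) n).
  by apply/allP => i; rewrite mem_ints; lia.
rewrite -[RHS]cats0; congr (_ ++ _); rewrite -[RHS](filter_pred0 (ints (1 - n%:Z + n%:Z) n)).
by apply/eq_in_filter => i; rewrite mem_ints /=; lia.
Qed.

(** The unsigned form of the theorem on a finite square with [d] columns to the west of the
    region. *)
Lemma sq_sum_rect n d w : in_S n w -> let lo := 1 - n%:Z - d%:Z in
  sq_sum lo (d + n.*2) w =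
  \sum_(D : tiling n | `[< rect_KBPD w D >])
    wt D * sq_sum lo (d + n.*2) (w_part (lambda D)).
Proof.
move=> wS lo.
pose K := grid_sum series (sq_rows lo (d + n) id) (sq_cols lo (d + n.*2)) (no_pipe series).
pose sd := [seq Some j | j <- ints lo d].
have eids : sq_rows lo (d + n) w = sq_rows lo (d + n) id.
  apply: eq_sq_rows => i; rewrite mem_ints => hi; apply: wS.2; rewrite /lo in hi; lia.
have elo : lo + d%:Z = 1 - n%:Z by rewrite /lo; lia.
have KV : vanishes series (d + n.*2) K.
  have := vanishes_top series lo (d + n) (fun i => 1 - x_ i) (sq_cols lo (d + n.*2)).
  by rewrite size_sq_cols.
have pos : all (pos_exit series) (sq_rows 1 n w).
  apply/allP => r /mapP[i]; rewrite mem_ints => hi -> /=.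
  by have := in_S_range n w i wS; rewrite /pos_exit /=; lia.
have eints : ints (1 - n%:Z) n.*2 = ints (1 - n%:Z) n ++ ints 1 n.
  by rewrite -addnn ints_cat; congr (_ ++ ints _ _); lia.
have stripE : sq_sum lo (d + n.*2) w =
    grid_sum series (sq_rows 1 n w) (sq_cols (1 - n%:Z) n.*2) (fun l => K (sd ++ l))
      [seq Some j | j <- ints (1 - n%:Z) n.*2].
  rewrite sq_sum_split -/lo eids -/K /sq_cols ints_cat !map_cat elo eints [in LHS]map_cat.
  rewrite -/(sq_cols lo d) [in RHS]map_cat; apply: grid_sum_strip => //.
  - rewrite -elo -ints_cat; apply/allP => i; rewrite mem_ints /lo; lia.
  - rewrite -elo -ints_cat /ints sorted_map; apply: (sub_sorted _ (iota_ltn_sorted 0 _)).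
    by move=> a b /=; lia.
  - by rewrite !size_map.
  - by rewrite !size_map !size_cat !size_map.
  - by rewrite !size_map.
  - by rewrite !size_map !size_cat !size_map !size_iota addnn.
rewrite stripE grid_sum_tiles //; first last.
- by apply: vanishes_cat; rewrite /sd !size_map !size_iota.
- by rewrite !size_map.
have -> : size (sq_rows 1 n w) = n by rewrite !size_map size_iota.
have -> : size [seq Some j | j <- ints (1 - n%:Z) n.*2] = n.*2 by rewrite !size_map size_iota.
have e1 : [seq r.1 | r <- sq_rows 1 n w] = [seq 1 - x_ i | i <- ints 1 n].
  by rewrite /sq_rows -map_comp.
have e2 : [seq r.2 | r <- sq_rows 1 n w] = mkseq (fun i => Some (w i.+1%:Z)) n.
  by rewrite /sq_rows /ints -!map_comp; apply: eq_map => i /=; congr (Some (w _)); lia.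
have e3 : [seq Some j | j <- ints (1 - n%:Z) n.*2] =
    mkseq (fun j => Some (j%:Z + 1 - n%:Z)) n.*2.
  by rewrite /ints -map_comp; apply: eq_map => i /=; congr Some; lia.
rewrite -(sum_tilings n n.*2) [RHS]big_mkcond e1 e2; apply: eq_bigr => D _.
rewrite -wt_gwt; case: asboolP => [rD|nD].
  have [we [so lab]] := (rect_KBPDP n D w).1 rD.
  have [pE pl] := rect_labels_north n D w we so wS lab.
  rewrite pE eqxx; congr (_ * _); rewrite (lambdaE n D w we so lab); apply: sq_sum_north => //.
  by rewrite size_mkseq.
case pE : (pgrid _ _) => [[es l]|] //; case: eqP => // eE.
rewrite e3 in pE; have [we [so [l0 ln esE lE loc]]] := pgrid_ex _ _ _ _ _ _ pE.
(* A consistently labelled tiling with the right exits fails to be a pipedream only if a positive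
   pipe leaves north; the rows above have no exit for it, so its term is 0. *)
suff [j [p [hj ej p0]]] : exists j p, [/\ (j < n.*2)%N, so 0%N j = Some p & 0 < p].
  suff -> : K (sd ++ l) = 0 by rewrite mulr0.
  apply: (grid_sum_notin series p).
  - rewrite pmap_cat mem_cat; apply/orP; right; rewrite mem_pmap map_id lE; apply/mapP.
    by exists j; rewrite ?mem_iota // ej.
  - apply/allP => r /mapP[i]; rewrite mem_ints => hi ->; apply/eqP => -[].
    by rewrite /lo in hi; lia.
  - by rewrite size_cat lE size_mkseq !size_map !size_iota.
apply: contrapT => no; apply: nD; apply/rect_KBPDP; exists we, so; split=> //.
- by move=> j hj; rewrite ln.
- move=> i hi; have := congr1 (fun s => nth None s i) (etrans (esym esE) eE).
  by rewrite !nth_mkseq.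
- by move=> j p hj ej; rewrite leNgt; apply/negP => p0; apply: no; exists j, p.
Qed.

Theorem theorem6p9 (n : nat) (w : int -> int) (hw : in_S n w) :
  bs_groth w =
  (-1) ^+ len w *
  \sum_(D : tiling n | `[< rect_KBPD w D >])
    (-1) ^+ sumn (lambda D) * wt D * G_part (lambda D).
Proof.
have sgK (A : comNzRingType) (k : nat) (a b : A) : (-1) ^+ k * a = b -> a = (-1) ^+ k * b.
  by move=> <-; rewrite mulrA -exprD addnn -mul2n exprM sqrrN !expr1n mul1r.
apply: (sgK series).
have c1 := bs_groth_cvg 0 n w (in_box_in_S n w hw).
suff c2 : cvg_minfty (fun p => sq_sum p `|(n%:Z + 1)%R - p|%N w)
    (\sum_(D : tiling n | `[< rect_KBPD w D >])
       (-1) ^+ sumn (lambda D) * wt D * G_part (lambda D)).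
  exact: etrans (esym (lim_minftyE _ _ c1)) (lim_minftyE _ _ c2).
pose u (D : tiling n) p := wt D * sq_sum p `|(n%:Z + 1)%R - p|%N (w_part (lambda D)).
apply: (cvg_minfty_eq (fun p => \sum_(D : tiling n | `[< rect_KBPD w D >]) u D p) _ _
  (1 - n%:Z)).
  (* A square beginning at [p] has [d = 1 - n - p] columns to the west of the region. *)
  move=> p hp; have := sq_sum_rect n `|(1 - n%:Z)%R - p|%N w hw; rewrite /=.
  have -> : 1 - n%:Z - (`|(1 - n%:Z)%R - p|%N)%:Z = p by lia.
  have -> : (`|(1 - n%:Z)%R - p| + n.*2)%N = `|(n%:Z + 1)%R - p|%N by lia.
  exact: esym.
apply: cvg_minfty_sum => D /asboolP rD.
have [we [so lab]] := (rect_KBPDP n D w).1 rD.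
have [_ pl] := rect_labels_north n D w we so hw lab.
have sl : size (lambda D) = n.
  by rewrite (lambdaE n D w we so lab) size_north_part // size_mkseq.
have lamle i : (nth 0%N (lambda D) i <= n)%N by apply: path_part_le.
have lamdecr i k : (i <= k)%N -> (k < size (lambda D))%N ->
    (nth 0%N (lambda D) k <= nth 0%N (lambda D) i)%N by apply: path_part_decr.
have c3 := bs_groth_cvg n n _ (w_part_in_box n _ lamdecr lamle sl).
(* By parity, the sign that comes with the limit for [w_part (lambda D)] is the sign of the
   shape. *)
have sgE (A : comNzRingType) (a b : A) :
    a * ((-1) ^+ len (w_part (lambda D)) * b) = (-1) ^+ sumn (lambda D) * a * b.
  by rewrite -signr_odd (odd_len_w_part n _ lamle sl) signr_odd mulrCA mulrA.
have := cvg_minftyM (wt D) _ _ c3; rewrite (sgE series (wt D)) /u.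
exact.
Qed.
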